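(* Let $F:M^2\rightarrow\mathbb{S}^2(1)\times\mathbb{R}\subset\mathbb{E}^4$ be a totally umbilical surface with shape operator $S=\lambda\,\mathrm{id}$ and angle function $\theta$, which is not totally geodesic. Then one can choose local coordinates $(u,v)$ on $M^2$ such that $\lambda$ and $\theta$ only depend on $u$ and $$\theta(u)=\arctan\left(\frac{2ce^{\pm cu}}{1-c^2+e^{\pm 2cu}}\right), \qquad \lambda(u)=\frac{\theta'(u)}{\sin\theta(u)},$$ for some real constant $c>0$ (with the same choice of sign in both exponents). Moreover, the immersion is, up to an isometry of $\mathbb{S}^2(1)\times\mathbb{R}$, locally given by $$F(u,v)=\frac{1}{c}\left(\lambda,\,\sin\theta\,\cos v,\,\sin\theta\,\sin v,\,c\int\sin^2\theta\,du\right).$$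
   Context: $\mathbb{E}^4$ is Euclidean 4-space and $\mathbb{S}^2(1)\times\mathbb{R}=\{(x_1,x_2,x_3,x_4)\in\mathbb{E}^4 \mid x_1^2+x_2^2+x_3^2=1\}$ with the induced (product) metric. Let $e_3=(0,0,0,1)$ be the unit vector field tangent to the $\mathbb{R}$-factor. $F$ is an isometric immersion of an oriented surface $M^2$; $\xi$ denotes a unit normal along $M^2$, tangent to $\mathbb{S}^2(1)\times\mathbb{R}$; $S$ is the associated shape operator, $SX=-\widetilde{\nabla}_X\xi$ with $\widetilde{\nabla}$ the Levi Civita connection of $\mathbb{S}^2(1)\times\mathbb{R}$. The angle function $\theta$ is the angle between $e_3$ and $\xi$; working locally, one may assume $\theta\in[0,\frac{\pi}{2}]$ (by choice of $\xi$). The surface is totally umbilical if $S=\lambda\,\mathrm{id}$ at every point, for a function $\lambda$ on $M^2$; it is totally geodesic if moreover $\lambda\equiv0$. The symbol $\int\sin^2\theta\,du$ denotes an antiderivative of $\sin^2\theta(u)$.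
   Formalization: The local coordinates and formulas are claimed only around points where θ ≠ 0: at a point with θ = 0 (such as a pole of an umbilical sphere) the displayed θ(u), which never vanishes, cannot hold; points with 0 < θ < π and θ ≠ π/2 are also shown to be dense. *)

(* Defs.v *)
From HB Require Import structures.
From mathcomp Require Import all_boot all_order all_algebra.
From mathcomp Require Import all_classical all_reals all_analysis.

Set Implicit Arguments.
Unset Strict Implicit.
Unset Printing Implicit Defensive.

Import Order.TTheory GRing.Theory Num.Theory.
Import numFieldNormedType.Exports.

Local Open Scope classical_set_scope.
Local Open Scope ring_scope.

(* C^infinity on U: every iterated directional derivative is (Frechet)
   differentiable at every point of U.  Meant for open U. *)
Definition smooth_on (R : realType) (m n : nat) (U : set 'rV[R]_m)
    (f : 'rV[R]_m -> 'rV[R]_n) : Prop :=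
  forall (s : seq 'rV[R]_m) (x : 'rV[R]_m), U x ->
    differentiable (foldr (fun v g => 'D_v g) f s) x.

(* A homeomorphism [cmap] from the open set [cdom] of M onto the open set
   [cimg] of R^2, with inverse [cinv]; both maps are total functions whose
   values outside [cdom], resp. [cimg], are irrelevant. *)
Record chart (R : realType) (M : topologicalType) := Chart {
  cdom : set M;
  cimg : set 'rV[R]_2;
  cmap : M -> 'rV[R]_2;
  cinv : 'rV[R]_2 -> M;
  cdom_open : open cdom;
  cimg_open : open cimg;
  cmap_img : forall p, cdom p -> cimg (cmap p);
  cinv_dom : forall z, cimg z -> cdom (cinv z);
  cmapK : forall p, cdom p -> cinv (cmap p) = p;
  cinvK : forall z, cimg z -> cmap (cinv z) = z;
  cmap_cont : {within cdom, continuous cmap};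
  cinv_cont : {within cimg, continuous cinv} }.

Definition transition (R : realType) (M : topologicalType) (x y : chart R M) :
    'rV[R]_2 -> 'rV[R]_2 :=
  cmap y \o cinv x.

Definition compatible (R : realType) (M : topologicalType) (x y : chart R M) :
    Prop :=
  smooth_on (cmap x @` (cdom x `&` cdom y)) (transition x y) /\
  smooth_on (cmap y @` (cdom x `&` cdom y)) (transition y x).

(* M with the atlas A is a connected oriented smooth surface; the orientation is
   the one for which the charts of A are positive. *)
Record oriented_surface (R : realType) (M : topologicalType)
    (A : set (chart R M)) : Prop := OrientedSurface {
  surface_hausdorff : hausdorff_space M;
  surface_countable : @second_countable M;
  surface_connected : connected [set: M];
  surface_cover : forall p : M, exists2 x, A x & cdom x p;
  surface_smooth : forall x y, A x -> A y -> compatible x y;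
  surface_oriented : forall x y p, A x -> A y -> cdom x p -> cdom y p ->
    0 < \det ('J (transition x y) (cmap x p)) }.

(* Local coordinates on (M, A): a chart of the maximal atlas generated by A. *)
Definition local_coordinates (R : realType) (M : topologicalType)
    (A : set (chart R M)) (x : chart R M) : Prop :=
  forall y, A y -> compatible x y.

Definition smooth_map (R : realType) (M : topologicalType)
    (A : set (chart R M)) (n : nat) (f : M -> 'rV[R]_n) : Prop :=
  forall x, A x -> smooth_on (cimg x) (f \o cinv x).

(* df_p(X), where the tangent vector X at p has components w in the chart x. *)
Definition dmap (R : realType) (M : topologicalType) (n : nat)
    (x : chart R M) (f : M -> 'rV[R]_n) (p : M) (w : 'rV[R]_2) : 'rV[R]_n :=
  'D_w (f \o cinv x) (cmap x p).

Definition dot (R : realType) (n : nat) (v w : 'rV[R]_n) : R :=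
  \sum_i v 0 i * w 0 i.

Definition vec4 (R : realType) (a b c d : R) : 'rV[R]_4 :=
  \row_i [:: a; b; c; d]`_i.

Definition S2xR (R : realType) : set 'rV[R]_4 :=
  [set y | y 0 0 ^+ 2 + y 0 1 ^+ 2 + y 0 2 ^+ 2 = 1].

Definition e3 (R : realType) : 'rV[R]_4 := vec4 0 0 0 1.

(* Unit normal of S^2(1) x R in E^4 at y. *)
Definition nu (R : realType) (y : 'rV[R]_4) : 'rV[R]_4 :=
  vec4 (y 0 0) (y 0 1) (y 0 2) 0.

Definition tangent (R : realType) (y : 'rV[R]_4) : set 'rV[R]_4 :=
  [set w | dot w (nu y) = 0].

(* Immersion into S^2(1) x R.  M carries the metric induced by F, so that F is
   isometric. *)
Record immersion (R : realType) (M : topologicalType) (A : set (chart R M))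
    (F : M -> 'rV[R]_4) : Prop := Immersion {
  immersion_smooth : smooth_map A F;
  immersion_range : forall p, S2xR (F p);
  immersion_inj : forall x p w, A x -> cdom x p -> dmap x F p w = 0 -> w = 0 }.

Record unit_normal (R : realType) (M : topologicalType) (A : set (chart R M))
    (F xi : M -> 'rV[R]_4) : Prop := UnitNormal {
  normal_smooth : smooth_map A xi;
  normal_tangent : forall p, tangent (F p) (xi p);
  normal_unit : forall p, dot (xi p) (xi p) = 1;
  normal_orth : forall x p w, A x -> cdom x p ->
    dot (xi p) (dmap x F p w) = 0 }.

(* Levi-Civita connection of S^2(1) x R along F: the component tangent to
   S^2(1) x R of the derivative in E^4. *)
Definition nabla (R : realType) (M : topologicalType) (F : M -> 'rV[R]_4)
    (x : chart R M) (Y : M -> 'rV[R]_4) (p : M) (w : 'rV[R]_2) : 'rV[R]_4 :=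
  let DY := dmap x Y p w in DY - dot DY (nu (F p)) *: nu (F p).

(* dF(S X), for X with components w in the chart x. *)
Definition shape (R : realType) (M : topologicalType) (F xi : M -> 'rV[R]_4)
    (x : chart R M) (p : M) (w : 'rV[R]_2) : 'rV[R]_4 :=
  - nabla F x xi p w.

(* S = lambda id; since dF is injective this is dF(S X) = lambda dF(X). *)
Definition totally_umbilical (R : realType) (M : topologicalType)
    (A : set (chart R M)) (F xi : M -> 'rV[R]_4) (lambda : M -> R) : Prop :=
  forall x p w, A x -> cdom x p ->
    shape F xi x p w = lambda p *: dmap x F p w.

Definition totally_geodesic (R : realType) (M : topologicalType)
    (A : set (chart R M)) (F xi : M -> 'rV[R]_4) : Prop :=
  totally_umbilical A F xi (fun=> 0).

Definition angle (R : realType) (M : topologicalType) (xi : M -> 'rV[R]_4)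
    (p : M) : R :=
  acos (dot (e3 R) (xi p)).

(* Riemannian isometry of S^2(1) x R: a bijection which is locally the
   restriction of a smooth map of E^4 whose differential preserves the inner
   product on the tangent spaces.  Values outside S^2(1) x R are irrelevant. *)
Definition isometry_S2xR (R : realType) (Phi : 'rV[R]_4 -> 'rV[R]_4) : Prop :=
  set_bij (@S2xR R) (@S2xR R) Phi /\
  forall y, S2xR y -> exists (W : set 'rV[R]_4) (Psi : 'rV[R]_4 -> 'rV[R]_4),
    [/\ open W, W y, smooth_on W Psi,
        forall z, W z -> S2xR z -> Phi z = Psi z &
        forall v w, tangent y v -> tangent y w ->
          dot ('D_v Psi y) ('D_w Psi y) = dot v w].

Definition theta_den (R : realType) (c : R) (s : bool) (u : R) : R :=
  1 - c ^+ 2 + expR ((-1) ^+ s * (2 * c * u)).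

(* The sign in both exponents is + for s = false and - for s = true. *)
Definition theta_fun (R : realType) (c : R) (s : bool) (u : R) : R :=
  atan (2 * c * expR ((-1) ^+ s * (c * u)) / theta_den c s u).

(* Main.v *)
Require Import Defs.
From HB Require Import structures.
From mathcomp Require Import all_boot all_order all_algebra.
From mathcomp Require Import all_classical all_reals all_analysis.
From mathcomp Require Import perm ring lra.

Set Implicit Arguments.
Unset Strict Implicit.
Unset Printing Implicit Defensive.

Import Order.TTheory GRing.Theory Num.Theory.
Import numFieldNormedType.Exports.

Local Open Scope classical_set_scope.
Local Open Scope ring_scope.

(* Write F = (x, h), xi = (n, C) with x, n in R^3, so that C = cos theta.
   Umbilicity reads dn = - lambda dx + C x dh and dC = - lambda dh, and the
   Codazzi equation gives d lambda = - C dh.  Hence the vector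
   a = lambda x + n and the functions exp(h) (lambda + C) and
   exp(- h) (lambda - C) are constant on M.  With c = |a| one gets
   <a, x> = lambda and c^2 = lambda^2 + sin^2 theta.  If lambda and C vanished
   at one point, the two exponential invariants would force lambda = 0
   everywhere, so M would be totally geodesic; this gives both the density of
   the generic points and C > 0 where theta <= pi/2.  Near such a point,
   E = (c C -+ lambda) / sin theta defines u by exp(+- c u) = E, and v is the
   polar angle of x around the axis a.  The map (u, v) is an immersion because
   F is determined by (u, v), so the inverse function theorem makes it a
   chart. *)

(** * Iterated differentiability *)

(** [lambda] is given only as a function, so its differentiability must first be recovered from the
    umbilicity equation. The angle alone cannot serve to define u: theta' = lambda sin theta
    vanishes where lambda does, and such points are allowed. The quantity E involves lambda as well,
    and u stays regular there because dh = sin^2 theta du. The sign is chosen so that m = -+ lambda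
    is nonnegative at the given point; then c C + m > 0 nearby, and the exponential invariant with
    factor C + m is positive on all of M. Its logarithm expresses the height as +- ln (C + m) up to
    a constant, and this is matched with an explicit primitive of sin^2 theta. Thus no differential
    equation is solved: the formulas in u are checked algebraically from m^2 + 1 - C^2 = c^2. *)

Lemma differentiableP_eps (R : realType) (X V : normedModType R) (f : X -> V) x :
  differentiable f x <-> exists L : {linear X -> V}, continuous L /\
    forall e : R, 0 < e -> \forall h \near 0, `|f (h + x) - f x - L h| <= e * `|h|.
Proof.
split.
- move=> /diff_locallyP[dc df]; exists ('d f x); split=> // e e0.
  move/eqaddoP: df => /(_ e e0); apply: filterS => h.
  by rewrite /= opprD addrA.
- move=> [L [Lc Lf]].
  have fL : f \o shift x = cst (f x) + L +o_ 0 id.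
    apply/eqaddoP => e e0; have := Lf e e0; apply: filterS => h /=.
    by rewrite opprD addrA.
  have dL : 'd f x = L :> (X -> V) by exact: diff_unique.
  by apply/diff_locallyP; rewrite dL.
Qed.

Lemma near_eq_differentiable (R : realType) (X V : normedModType R)
    (f g : X -> V) x :
  (\forall y \near x, f y = g y) -> differentiable f x -> differentiable g x.
Proof.
move=> fg /differentiableP_eps[L [Lc Lf]]; apply/differentiableP_eps.
exists L; split=> // e e0; have fgx := nbhs_singleton fg.
have : \forall h \near (0 : X), f (h + x) = g (h + x).
  by move: fg; rewrite (near_shift 0) /=; apply: filterS => h; rewrite subr0.
move=> fg0; move: (Lf e e0); apply: filterS2 fg0 => h hE.
by rewrite hE fgx.
Qed.

(* Iterated directional derivatives of order at most k are differentiable, so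
   Cn 0 is differentiability, not continuity. *)
Definition Cn (R : realType) (X V : normedModType R) (k : nat) (U : set X)
    (f : X -> V) : Prop :=
  forall (s : seq X) (x : X), (size s <= k)%N -> U x ->
    differentiable (foldr (fun v g => 'D_v g) f s) x.

Lemma smooth_onP (R : realType) (m n : nat) (U : set 'rV[R]_m)
    (f : 'rV[R]_m -> 'rV[R]_n) : smooth_on U f <-> forall k, Cn k U f.
Proof.
by split=> [fU k s x _ Ux|fU s x Ux]; [exact: fU|exact: (fU (size s))].
Qed.

Section Cn_basic.
Variables (R : realType) (X V : normedModType R).
Implicit Types (U : set X) (f g : X -> V).

Lemma Cn_differentiable k U f x : Cn k U f -> U x -> differentiable f x.
Proof. by move=> /(_ [::] x isT). Qed.

(** The list is split at its last entry, the direction differentiated first. The product, quotient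
    and chain rules then follow by induction on [k], with one use of the first-order rule at each
    stage. *)
Lemma CnS k U f : Cn k.+1 U f <->
  (forall x, U x -> differentiable f x) /\ forall v, Cn k U ('D_v f).
Proof.
split=> [fU|[f0 fS] s x sk Ux].
  split=> [x /(fU [::]) //|v s x sk Ux]; first exact.
  by have := fU (rcons s v) x; rewrite size_rcons foldr_rcons; exact.
case/lastP: s sk => [_|s v]; first exact: f0.
by rewrite size_rcons foldr_rcons => sk; exact: fS.
Qed.

Lemma Cn_leq k l U f : (k <= l)%N -> Cn l U f -> Cn k U f.
Proof. by move=> kl fU s x sk; apply: fU; exact: leq_trans sk kl. Qed.

Lemma Cn_subset k U W f : W `<=` U -> Cn k U f -> Cn k W f.
Proof. by move=> WU fU s x sk /WU; exact: fU. Qed.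

Lemma Cn_ext k U f g : open U -> (forall x, U x -> f x = g x) ->
  Cn k U f -> Cn k U g.
Proof.
move=> oU; elim: k f g => [|k IH] f g fg.
  move=> fU [|//] x _ Ux; apply: near_eq_differentiable (fU [::] x isT Ux).
  by near do apply: fg; exact: open_nbhs_nbhs.
move=> /CnS[f0 fS]; apply/CnS; split=> [x Ux|v].
  apply: near_eq_differentiable (f0 x Ux).
  by near do apply: fg; exact: open_nbhs_nbhs.
apply: IH (fS v) => x Ux; apply: near_eq_derive.
by near do apply: fg; exact: open_nbhs_nbhs.
Unshelve. all: by end_near. Qed.

Lemma Cn_cst k U (a : V) : Cn k U (fun=> a).
Proof.
elim: k a => [|k IH] a; first by move=> [|//] x _ _; exact: differentiable_cst.
apply/CnS; split=> [x _|v]; first exact: differentiable_cst.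
suff -> : 'D_v (fun=> a) = fun=> 0 :> V by exact: IH.
by apply/funext => x; exact: derive_cst.
Qed.

Lemma CnD k U f g : open U -> Cn k U f -> Cn k U g -> Cn k U (f \+ g).
Proof.
move=> oU; elim: k f g => [|k IH] f g fU gU.
  by move=> [|//] x _ Ux; apply: differentiableD; [exact: (fU [::])|exact: (gU [::])].
have [f0 fS] := (CnS _ _ _).1 fU; have [g0 gS] := (CnS _ _ _).1 gU.
apply/CnS; split=> [x Ux|v]; first by apply: differentiableD; [exact: f0|exact: g0].
apply: Cn_ext (IH _ _ (fS v) (gS v)) => // x Ux.
rewrite [RHS]deriveD //; apply: diff_derivable; [exact: f0|exact: g0].
Qed.

End Cn_basic.

Section Cn_scalar.
Variables (R : realType) (X : normedModType R).
Implicit Types (U : set X) (f g : X -> R).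

Lemma CnM k U f g : open U -> Cn k U f -> Cn k U g -> Cn k U (f \* g).
Proof.
move=> oU; elim: k f g => [|k IH] f g fU gU.
  by move=> [|//] x _ Ux; apply: differentiableM; [exact: (fU [::])|exact: (gU [::])].
have [f0 fS] := (CnS _ _ _).1 fU; have [g0 gS] := (CnS _ _ _).1 gU.
apply/CnS; split=> [x Ux|v]; first by apply: differentiableM; [exact: f0|exact: g0].
have fk := Cn_leq (leqnSn k) fU; have gk := Cn_leq (leqnSn k) gU.
apply: Cn_ext (CnD oU (IH _ _ fk (gS v)) (IH _ _ gk (fS v))) => // x Ux.
rewrite [RHS]deriveM //; apply: diff_derivable; [exact: f0|exact: g0].
Qed.

Lemma CnN k U f : open U -> Cn k U f -> Cn k U (fun x => - f x).
Proof.
move=> oU fU; apply: Cn_ext (CnM oU (@Cn_cst _ _ _ k U (-1 : R)) fU) => // x _.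
by rewrite /= mulN1r.
Qed.

Lemma Cn_sum k U (I : Type) (r : seq I) (P : pred I) (F : I -> X -> R) :
  open U -> (forall i, P i -> Cn k U (F i)) ->
  Cn k U (fun x => \sum_(i <- r | P i) F i x).
Proof.
move=> oU FU; elim: r => [|i r IH].
  by apply: Cn_ext (@Cn_cst _ _ _ k U (0 : R)) => // x _; rewrite big_nil.
have [Pi|nPi] := boolP (P i).
  by apply: Cn_ext (CnD oU (FU i Pi) IH) => // x _; rewrite big_cons Pi.
by apply: Cn_ext IH => // x _; rewrite big_cons (negbTE nPi).
Qed.

Lemma Cn_prod k U (I : Type) (r : seq I) (P : pred I) (F : I -> X -> R) :
  open U -> (forall i, P i -> Cn k U (F i)) ->
  Cn k U (fun x => \prod_(i <- r | P i) F i x).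
Proof.
move=> oU FU; elim: r => [|i r IH].
  by apply: Cn_ext (@Cn_cst _ _ _ k U (1 : R)) => // x _; rewrite big_nil.
have [Pi|nPi] := boolP (P i).
  by apply: Cn_ext (CnM oU (FU i Pi) IH) => // x _; rewrite big_cons Pi.
by apply: Cn_ext IH => // x _; rewrite big_cons (negbTE nPi).
Qed.

Lemma derive_comp1 f (g : R -> R) (dg : R) x v : differentiable f x ->
  is_derive (f x) 1 g dg ->
  differentiable (g \o f) x /\ 'D_v (g \o f) x = 'D_v f x * dg.
Proof.
move=> df [gd gdE]; have gD : differentiable g (f x) by apply/derivable1_diffP.
have gfD := differentiable_comp df gD; split => //.
rewrite !deriveE // diff_comp //= -gdE deriveE //.
by rewrite -[in LHS](mulr1 ('d f x v)) [LHS]linearZ.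
Qed.

(** Asking only order [k] of [dg \o f] permits bootstrapping: in [CnV] the derivative of the inverse
    is a polynomial in the inverse itself. *)
Lemma Cn_comp1 k U f (g dg : R -> R) : open U ->
  (forall x, U x -> is_derive (f x) 1 g (dg (f x))) ->
  Cn k U (dg \o f) -> Cn k.+1 U f -> Cn k.+1 U (g \o f).
Proof.
move=> oU gD dgU /CnS[f0 fS]; apply/CnS; split=> [x Ux|v].
  by have [] := derive_comp1 0 (f0 x Ux) (gD x Ux).
apply: Cn_ext (CnM oU (fS v) dgU) => // x Ux /=.
by have [_ ->] := derive_comp1 v (f0 x Ux) (gD x Ux).
Qed.

Lemma CnV k U f : open U -> (forall x, U x -> f x != 0) ->
  Cn k U f -> Cn k U (fun x => (f x)^-1).
Proof.
move=> oU fn0; elim: k => [|k IH] fU.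
  by move=> [|//] x _ Ux; apply: differentiableV; [exact: (fU [::])|exact: fn0].
have iU := IH (Cn_leq (leqnSn k) fU).
apply: (@Cn_comp1 _ _ f (fun y => y^-1) (fun y => - (y^-1 * y^-1))) => //.
  move=> x Ux; have := @is_deriveV _ id (f x) 1 1 (fn0 x Ux) (is_derive_id _ _).
  by rewrite -[_ *: 1]/(_ * 1) mulr1 -exprVn expr2.
exact/CnN/CnM.
Qed.

Lemma Cn_comp1_weak k U f (g dg : R -> R) : open U ->
  (forall x, U x -> is_derive (f x) 1 g (dg (f x))) ->
  Cn k U (dg \o f) -> Cn k U f -> Cn k U (g \o f).
Proof.
move=> oU gD; case: k => [_ fU [|//] x _ Ux|k dgU].
  by have [] := derive_comp1 0 (Cn_differentiable fU Ux) (gD x Ux).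
by apply: Cn_comp1 gD _ => //; exact: Cn_leq dgU.
Qed.

Lemma Cn_ln k U f : open U -> (forall x, U x -> 0 < f x) ->
  Cn k U f -> Cn k U (fun x => ln (f x)).
Proof.
move=> oU f0 fU; apply: (@Cn_comp1_weak _ _ f _ GRing.inv) => //.
  by move=> x Ux; apply: is_derive1_ln; exact: f0.
by apply: CnV => // x Ux; rewrite gt_eqF// f0.
Qed.

Lemma Cn_atan k U f : open U -> Cn k U f -> Cn k U (fun x => atan (f x)).
Proof.
move=> oU fU; apply: (@Cn_comp1_weak _ _ f _ (fun y => (1 + y ^+ 2)^-1)) => //.
apply: CnV => // [x Ux|]; first by rewrite gt_eqF// ltr_pwDl// sqr_ge0.
exact: (CnD oU (@Cn_cst _ _ _ k U (1 : R)) (CnM oU fU fU)).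
Qed.

End Cn_scalar.

Section row_valued.
Variables (R : realType) (X : normedModType R) (n : nat).
Implicit Types (U : set X) (f : X -> 'rV[R]_n).

Lemma differentiable_rVP f x :
  differentiable f x <-> forall i, differentiable (fun y => f y 0 i) x.
Proof.
split=> [fx i|fx].
  by apply: (@differentiable_comp _ _ _ _ f (fun y : 'rV[R]_n => y 0 i : R)) => //;
    exact: differentiable_coord.
suff -> : f = \sum_i (fun y => f y 0 i *: (delta_mx 0 i : 'rV[R]_n)).
  by apply: differentiable_sum => i; exact: differentiableZl.
by apply/funext => y; rewrite fct_sumE [LHS]row_sum_delta.
Qed.

Lemma derive_rV f x v i : differentiable f x ->
  ('D_v f x) 0 i = 'D_v (fun y => f y 0 i) x.
Proof. by move=> fx; rewrite derive_mx ?mxE//; exact: diff_derivable. Qed.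

Lemma Cn_rVP k U f : open U ->
  Cn k U f <-> forall i, Cn k U (fun y => f y 0 i).
Proof.
move=> oU; elim: k f => [|k IH] f.
  split=> [fU i [|//] x _ Ux|fU [|//] x _ Ux].
    exact: ((differentiable_rVP _ _).1 (Cn_differentiable fU Ux)).
  by apply/differentiable_rVP => i; exact: (fU i [::]).
split=> [/CnS[f0 fS] i|fU].
  apply/CnS; split=> [x Ux|v]; first exact: ((differentiable_rVP _ _).1 (f0 x Ux)).
  by apply: Cn_ext ((IH _).1 (fS v) i) => // x Ux; rewrite derive_rV//; exact: f0.
have f0 x : U x -> differentiable f x.
  by move=> Ux; apply/differentiable_rVP => i; exact: (fU i [::]).
apply/CnS; split=> // v; apply/IH => i.
have [_ /(_ v)] := (CnS _ _ _).1 (fU i); apply: Cn_ext => // x Ux.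
by rewrite derive_rV//; exact: f0.
Qed.

Lemma derive_comp_rV f (g : 'rV[R]_n -> R) x v : differentiable f x ->
  differentiable g (f x) ->
  'D_v (g \o f) x = \sum_i ('D_v f x) 0 i * 'D_(delta_mx 0 i) g (f x).
Proof.
move=> fx gx; rewrite deriveE; last exact: differentiable_comp.
rewrite diff_comp //= -(deriveE _ fx) [in LHS](row_sum_delta ('D_v f x)) raddf_sum /=.
by apply: eq_bigr => i _; rewrite linearZ /= (deriveE _ gx).
Qed.

Lemma Cn_comp k U (W : set 'rV[R]_n) f (g : 'rV[R]_n -> R) : open U ->
  (forall x, U x -> W (f x)) -> Cn k U f -> Cn k W g -> Cn k U (g \o f).
Proof.
move=> oU fUW; elim: k g => [|k IH] g fU gW.
  move=> [|//] x _ Ux; apply: differentiable_comp; first exact: (fU [::]).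
  exact: (gW [::] _ _ (fUW _ Ux)).
have fk := Cn_leq (leqnSn k) fU.
have [g0 gS] := (CnS _ _ _).1 gW; have [f0 fS] := (CnS _ _ _).1 fU.
apply/CnS; split=> [x Ux|v].
  by apply: differentiable_comp; [exact: f0|exact/g0/fUW].
have : Cn k U (fun x => \sum_i ('D_v f x) 0 i * 'D_(delta_mx 0 i) g (f x)).
  apply: Cn_sum => // i _; apply: (@CnM _ _ _ _ (fun x => ('D_v f x) 0 i)) => //.
    exact: ((Cn_rVP _ _ _).1 (fS v)).
  exact: (IH ('D_(delta_mx 0 i) g)).
apply: Cn_ext => // x Ux; rewrite derive_comp_rV//; first exact: f0.
exact/g0/fUW.
Qed.

End row_valued.

Lemma Cn_comp_rV (R : realType) (X : normedModType R) (m n k : nat) (U : set X)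
    (W : set 'rV[R]_m) (f : X -> 'rV[R]_m) (g : 'rV[R]_m -> 'rV[R]_n) :
  open U -> open W -> (forall x, U x -> W (f x)) -> Cn k U f -> Cn k W g ->
  Cn k U (g \o f).
Proof.
move=> oU oW fUW fU gW; apply/Cn_rVP => // i.
exact: (Cn_comp oU fUW fU ((Cn_rVP _ _ oW).1 gW i)).
Qed.

Lemma derive_coord (R : realType) (n : nat) (i : 'I_n) (v x : 'rV[R]_n) :
  'D_v (fun y : 'rV[R]_n => y 0 i) x = v 0 i.
Proof.
have := @derive_rV R 'rV[R]_n n id x v i; by rewrite derive_id => <-.
Qed.

Lemma Cn_id (R : realType) (n k : nat) (U : set 'rV[R]_n) : open U ->
  Cn k U (id : 'rV[R]_n -> 'rV[R]_n).
Proof.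
move=> oU; apply/Cn_rVP => // i; case: k => [|k].
  by move=> [|//] x _ _; exact: differentiable_coord.
apply/CnS; split=> [x _|v]; first exact: differentiable_coord.
by apply: Cn_ext (@Cn_cst _ _ _ k U (v 0 i)) => // x _; rewrite derive_coord.
Qed.

(** * Mean values and symmetry of second derivatives *)

Section mean_value.
Variables (R : realType) (X : normedModType R).
Implicit Types f : X -> R.

Lemma is_derive_line f x v t : differentiable f (x + t *: v) ->
  is_derive t (1 : R) (fun s : R => f (x + s *: v)) ('D_v f (x + t *: v)).
Proof.
move=> fd.
pose l : R -> X := cst x + ( *:%R^~ v).
have ld : is_diff t l (0 + ( *:%R^~ v)) :=
  is_diffD (is_diff_cst x t) (is_diff_scalel t v).
have ldiff : differentiable l t by case: ld.
rewrite -[fun _ => _]/(f \o l).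
have cd : differentiable (f \o l) t.
  exact: differentiable_comp.
apply: DeriveDef; first exact: diff_derivable.
rewrite deriveE // diff_comp //=.
by rewrite (@diff_val _ _ _ _ _ _ _ ld) fctE add0r scale1r deriveE.
Qed.

Lemma mean_value f x v :
  (forall t : R, 0 <= t <= 1 -> differentiable f (x + t *: v)) ->
  exists2 t : R, 0 < t < 1 & f (x + v) - f x = 'D_v f (x + t *: v).
Proof.
move=> fd; have := @MVT R (fun s : R => f (x + s *: v))
  (fun s => 'D_v f (x + s *: v)) 0 1 ltr01.
case=> [t|t|t].
- by rewrite in_itv/= => /andP[t0 t1]; apply/is_derive_line/fd; rewrite !ltW.
- apply: derivable_within_continuous => s; rewrite in_itv/= => s01.
  by have [] := is_derive_line (fd s s01).
- rewrite in_itv/= => t01; rewrite scale1r scale0r addr0 subr0 mulr1 => E.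
  by exists t.
Qed.

End mean_value.

Lemma derive_scaler (R : realType) (X V : normedModType R) (f : X -> V) x v (k : R) :
  differentiable f x -> 'D_(k *: v) f x = k *: 'D_v f x.
Proof. by move=> fx; rewrite !deriveE// linearZ. Qed.

Lemma derive_dirD (R : realType) (X V : normedModType R) (f : X -> V) x v w :
  differentiable f x -> 'D_(v + w) f x = 'D_v f x + 'D_w f x.
Proof. by move=> fx; rewrite !deriveE// linearD. Qed.

Section symmetry_of_second_derivatives.
Variables (R : realType) (X : normedModType R).

(* Mean value theorem for y |-> f (y + t w) - f y; the second difference itself
   is symmetric in v and w. *)
Lemma second_difference (U : set X) (f : X -> R) x v w (e : R) :
  open U -> U x -> (forall y, U y -> differentiable f y) ->
  differentiable ('D_v f) x -> 0 < e ->
  \forall t \near (0 : R)^'+,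
    `|f (x + t *: v + t *: w) - f (x + t *: v) - f (x + t *: w) + f x
      - t ^+ 2 * 'D_w ('D_v f) x| <= e * t ^+ 2.
Proof.
move=> oU Ux fd dfd e0.
have [L [Lc Lf]] := (differentiableP_eps _ _).1 dfd.
have LE h : L h = 'd ('D_v f) x h.
  suff -> : 'd ('D_v f) x = L :> (X -> R) by [].
  apply: diff_unique => //; apply/eqaddoP => e' e'0; apply: filterS (Lf e' e'0) => h'.
  by rewrite /= opprD addrA.
(* [K] dominates the displacement per unit of [t] and also the sum of the two error terms, whence
   the factor 2. The summand 1 keeps it positive when [v] and [w] both vanish. *)
pose K := 2 * `|v| + 2 * `|w| + 1.
have K0 : 0 < K by rewrite ltr_wpDl// addr_ge0// mulr_ge0.
have eK : 0 < e / K by rewrite divr_gt0.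
have Unear : \forall h \near (0 : X), U (h + x).
  have : \forall y \near x, U y by exact: open_nbhs_nbhs.
  by rewrite (near_shift 0) /=; apply: filterS => h; rewrite subr0.
have : \forall h \near (0 : X), U (h + x) /\
    `|'D_v f (h + x) - 'D_v f x - L h| <= e / K * `|h|.
  by apply: filterI => //; exact: Lf.
move=> /nbhs_ballP[d /= d0 dP].
have {}dP (a b t : R) : 0 < t -> t * K < d -> 0 <= a <= 1 -> 0 <= b <= 1 ->
    U (x + (t * a) *: v + (t * b) *: w) /\
    `|'D_v f (x + (t * a) *: v + (t * b) *: w) - 'D_v f x
      - (t * a * L v + t * b * L w)| <= e / K * (t * (`|v| + `|w|)).
  move=> t0 tK /andP[a0 a1] /andP[b0 b1].
  pose h := (t * a) *: v + (t * b) *: w.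
  have hn : `|h| <= t * (`|v| + `|w|).
    rewrite (le_trans (ler_normD _ _))// !normrZ (gtr0_norm t0).
    rewrite (ger0_norm a0) (ger0_norm b0) mulrDr.
    by apply: lerD; rewrite ler_wpM2r// ler_piMr// ltW.
  have hd : ball (0 : X) d h.
    rewrite -ball_normE /= sub0r normrN (le_lt_trans hn)//.
    rewrite (le_lt_trans _ tK)// ler_wpM2l ?(ltW t0)// /K.
    have := normr_ge0 v; have := normr_ge0 w; lra.
  have := dP h hd; have -> : h + x = x + (t * a) *: v + (t * b) *: w.
    by rewrite addrC addrA.
  have -> : L h = t * a * L v + t * b * L w by rewrite linearD !linearZ.
  move=> [Uh dh]; split=> //; apply: le_trans dh _.
  by rewrite ler_wpM2l// ltW.
near=> t.
have t0 : 0 < t by near: t; exact: nbhs_right_gt.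
have tK : t * K < d.
  rewrite -ltr_pdivlMr//; near: t; apply: nbhs_right_lt.
  by rewrite divr_gt0.
pose g y := f (y + t *: w) - f y.
have gd a : 0 <= a <= 1 -> differentiable g (x + a *: (t *: v)) /\
    'D_(t *: v) g (x + a *: (t *: v)) =
    t * ('D_v f (x + (t * a) *: v + t *: w) - 'D_v f (x + (t * a) *: v)).
  move=> a01.
  have [U1 _] := dP a 1 t t0 tK a01 ltac:(by rewrite ler01 lexx).
  have [U0 _] := dP a 0 t t0 tK a01 ltac:(by rewrite ler01 lexx).
  move: U0 U1; rewrite mulr1 mulr0 scale0r addr0 scalerA (mulrC a) => U0 U1.
  set y := x + _ *: v.
  have sd : is_diff y (id + cst (t *: w)) (id + 0) :=
    is_diffD (is_diff_id y) (is_diff_cst (t *: w) y).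
  have f1 := is_diff_comp sd (differentiableP (fd _ U1)).
  have gy := is_diffB f1 (differentiableP (fd _ U0)).
  have gd : differentiable g y by case: gy.
  split=> //; rewrite deriveE // (@diff_val _ _ _ _ _ _ _ gy) !fctE /= addr0.
  by rewrite !linearZ /= -scalerDr -(deriveE v (fd _ U1)) -(deriveE v (fd _ U0)).
have [a /andP[a0 a1] gE] := mean_value (fun a a01 => (gd a a01).1).
have a01 : 0 <= a <= 1 by rewrite !ltW.
move: gE; rewrite (gd a a01).2 /g.
have [_] := dP a 1 t t0 tK a01 ltac:(by rewrite ler01 lexx).
have [_] := dP a 0 t t0 tK a01 ltac:(by rewrite ler01 lexx).
rewrite !mulr1 !mulr0 scale0r addr0 mul0r addr0.
have -> : 'D_w ('D_v f) x = L w by rewrite LE deriveE.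
set A := 'D_v f _; set B := 'D_v f _; set C := 'D_v f _.
move=> h1 h2 gE.
have -> : f (x + t *: v + t *: w) - f (x + t *: v) - f (x + t *: w) + f x =
    t * (C - A) by rewrite -gE; ring.
have -> : t * (C - A) - t ^+ 2 * L w = t * ((C - B - (t * a * L v + t * L w))
    - (A - B - t * a * L v)) by ring.
rewrite normrM (gtr0_norm t0) expr2 mulrCA ler_pM2l//.
apply: (le_trans (ler_normB _ _)); apply: le_trans (lerD h2 h1) _.
have -> : e * t = e / K * (t * K) by rewrite mulrACA mulVf ?gt_eqF// mulr1 mulrC.
by rewrite -mulrDr ler_pM2l// -mulrDr ler_pM2l// /K; lra.
Unshelve. all: by end_near. Qed.

(** Both mixed derivatives, multiplied by t^2, approximate the same second difference up to e t^2 /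
    2, so they differ by at most e, for every e > 0. *)
Lemma derive_comm (U : set X) (f : X -> R) x v w :
  open U -> U x -> Cn 2 U f -> 'D_v ('D_w f) x = 'D_w ('D_v f) x.
Proof.
move=> oU Ux fU.
have fd y : U y -> differentiable f y by exact: Cn_differentiable fU.
have f2 v' : differentiable ('D_v' f) x by exact: (fU [:: v'] x).
apply/eqP; rewrite -subr_eq0 -normr_le0; apply/ler_addgt0Pr => e e0.
have e2 : 0 < e / 2 by rewrite divr_gt0.
have H1 := @second_difference U f x v w _ oU Ux fd (f2 v) e2.
have H2 := @second_difference U f x w v _ oU Ux fd (f2 w) e2.
have [t [[+ +] t0]] := filter_ex (filterI (filterI H1 H2) (nbhs_right_gt 0)).
rewrite (addrAC x); move: ('D_w ('D_v f) x) ('D_v ('D_w f) x) => p q.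
move: (f _) (f (x + _)) (f (x + _)) (f x) => a b c d h1 h2.
have T0 := exprn_gt0 2 t0; set T := t ^+ 2 in T0 h1 h2.
rewrite add0r -(ler_pM2r T0).
have -> : `|q - p| * T = `|(q - p) * T| by rewrite normrM (gtr0_norm T0).
have -> : (q - p) * T = (a - c - b + d - T * p) - (a - b - c + d - T * q) by ring.
have -> : e * T = e / 2 * T + e / 2 * T by rewrite -mulrDl -splitr.
apply: (le_trans (ler_normB _ _)). exact: lerD.
Qed.

End symmetry_of_second_derivatives.

(** * The inverse function theorem *)

(** The inverse function theorem finds preimages as Banach fixed points in a space of row vectors,
    which must be complete as a normed space. *)
HB.instance Definition _ (R : realType) (m n : nat) :=
  Complete.on 'M[R]_(m, n).

Section row_vector_norm.
Variables (R : realType) (n : nat).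

Lemma rV_coord_norm (x : 'rV[R]_n) i : `|x 0 i| <= `|x|.
Proof.
rewrite [leRHS]/Num.Def.normr /= mx_normrE.
exact: (le_bigmax _ (fun ij : 'I_1 * 'I_n => `|x ij.1 ij.2|) (0, i)).
Qed.

Lemma rV_norm_le (x : 'rV[R]_n) (a : R) : 0 <= a -> (forall i, `|x 0 i| <= a) ->
  `|x| <= a.
Proof.
move=> a0 xa; rewrite [leLHS]/Num.Def.normr /= mx_normrE.
by apply: bigmax_le => // -[i j] _ /=; rewrite (ord1 i).
Qed.

End row_vector_norm.

Section matrix_Cn.
Variables (R : realType) (X : normedModType R).

Lemma Cn_mulmx k (m n : nat) (U : set X) (f : X -> 'rV[R]_m) (B : 'M[R]_(m, n)) :
  open U -> Cn k U f -> Cn k U (fun x => f x *m B).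
Proof.
move=> oU /(Cn_rVP _ _ oU) fU; apply/Cn_rVP => // j.
have : Cn k U (fun x => \sum_i f x 0 i * B i j).
  apply: Cn_sum => // i _; apply: (@CnM _ _ _ _ (fun x => f x 0 i)) => //.
  exact: Cn_cst.
by apply: Cn_ext => // x _; rewrite mxE.
Qed.

Lemma Cn_det k n (U : set X) (A : X -> 'M[R]_n) : open U ->
  (forall i j, Cn k U (fun x => A x i j)) -> Cn k U (fun x => \det (A x)).
Proof.
move=> oU AU.
have : Cn k U (fun x => \sum_(s : 'S_n) (-1) ^+ s * \prod_i A x i (s i)).
  apply: Cn_sum => // s _.
  apply: (CnM oU (@Cn_cst _ _ _ k U ((-1) ^+ s : R))); exact: Cn_prod.
by apply: Cn_ext.
Qed.

(** Cramer's rule: the entries of the inverse are cofactors divided by a determinant that does not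
    vanish on [U]. *)
Lemma Cn_invmx k n (U : set X) (A : X -> 'M[R]_n) : open U ->
  (forall x, U x -> A x \in unitmx) ->
  (forall i j, Cn k U (fun x => A x i j)) ->
  forall i j, Cn k U (fun x => invmx (A x) i j).
Proof.
move=> oU Au AU i j.
have : Cn k U (fun x => (\det (A x))^-1 * (\adj (A x)) i j).
  apply: (@CnM _ _ _ _ (fun x => (\det (A x))^-1)) => //.
    apply: CnV => //; last exact: Cn_det.
    by move=> x /Au; rewrite unitmxE unitfE.
  have : Cn k U (fun x => (-1) ^+ (j + i) * \det (row' j (col' i (A x)))).
    apply: (CnM oU (@Cn_cst _ _ _ k U ((-1) ^+ (j + i) : R))).
    apply: Cn_det => // i' j'; apply: Cn_ext (AU (lift j i') (lift i j')) => //.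
    by move=> x _; rewrite !mxE.
  by apply: Cn_ext => // x _; rewrite mxE.
by apply: Cn_ext => // x Ux; rewrite /invmx Au// !mxE.
Qed.

End matrix_Cn.

Lemma mulmx_continuous (R : realType) (m n : nat) (B : 'M[R]_(m, n)) :
  continuous (mulmxr B : 'rV[R]_m -> 'rV[R]_n).
Proof.
move=> v; apply: differentiable_continuous.
have oT : open [set: 'rV[R]_m] by exact: openT.
exact: (Cn_differentiable (Cn_mulmx B oT (@Cn_id _ _ 0 _ oT)) (I : setT v)).
Qed.

Lemma mulmx_lipschitz (R : realType) (m n : nat) (B : 'M[R]_(m, n)) :
  exists2 K : R, 0 < K & forall v : 'rV[R]_m, `|v *m B| <= K * `|v|.
Proof.
apply: (@linear_lipschitz R 'rV[R]_m 'rV[R]_n (mulmxr B)).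
exact: mulmx_continuous.
Qed.

Lemma derive_mulmx (R : realType) (X : normedModType R) (m n : nat)
    (f : X -> 'rV[R]_m) (B : 'M[R]_(m, n)) x v : differentiable f x ->
  'D_v (fun y => f y *m B) x = 'D_v f x *m B.
Proof.
move=> fx; have Bc := @mulmx_continuous R m n B.
have Bd y : differentiable (mulmxr B : 'rV[R]_m -> 'rV[R]_n) y.
  exact: linear_differentiable.
rewrite -[fun y => _]/((mulmxr B : 'rV[R]_m -> 'rV[R]_n) \o f).
rewrite !deriveE //; last exact: differentiable_comp.
by rewrite diff_comp //= diff_lin.
Qed.

Lemma jacobian_unit (R : realType) (n : nat) (f : 'rV[R]_n -> 'rV[R]_n) z :
  differentiable f z -> (forall w, 'D_w f z = 0 -> w = 0) -> 'J f z \in unitmx.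
Proof.
move=> fz f0; rewrite -row_free_unit -kermx_eq0.
apply/eqP/row_matrixP => i; rewrite row0; apply: f0.
by rewrite deriveEjacobian// -row_mul mulmx_ker row0.
Qed.

Lemma jacobianE (R : realType) (n m : nat) (f : 'rV[R]_n -> 'rV[R]_m) z i j :
  differentiable f z -> 'J f z i j = ('D_(delta_mx 0 i) f z) 0 j.
Proof. by move=> fz; rewrite deriveEjacobian// -rowE [RHS]mxE. Qed.

Section inverse_function_theorem.
Variables (R : realType) (n : nat).
Implicit Types (U : set 'rV[R]_n) (f : 'rV[R]_n -> 'rV[R]_n).

(** The partial derivatives of [g] are continuous and vanish at [z0], hence are small on a ball; the
    mean value theorem on segments of this ball, one coordinate at a time, gives the Lipschitz
    bound. *)
Lemma contraction_near_critical U (g : 'rV[R]_n -> 'rV[R]_n) z0 :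
  open U -> U z0 -> Cn 2 U g -> (forall w, 'D_w g z0 = 0) ->
  exists2 r : R, 0 < r & forall z, `|z - z0| < r -> U z /\
    (forall w, `|'D_w g z| <= 2^-1 * `|w|) /\
    (forall z', `|z' - z0| < r -> `|g z - g z'| <= 2^-1 * `|z - z'|).
Proof.
move=> oU Uz0 gU g0.
(* A sum of [n] partial derivatives bounded by [e] is at most 1/2; the successor avoids a division
   by zero when [n] is 0. *)
pose e : R := (2 * n.+1%:R)^-1.
have e0 : 0 < e by rewrite invr_gt0 mulr_gt0.
have [gd gS] := (CnS _ _ _).1 gU.
have Dg i j : \forall z \near z0, `|('D_(delta_mx 0 i) g z) 0 j| <= e.
  have := (differentiable_rVP _ _).1 (Cn_differentiable (gS (delta_mx 0 i)) Uz0) j.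
  move=> /differentiable_continuous /cvgrPdist_le /(_ e e0).
  by apply: filterS => z; rewrite g0 mxE sub0r normrN.
have Unear : \forall z \near z0, U z by exact: open_nbhs_nbhs.
have : \forall z \near z0, U z /\ forall i j,
    `|('D_(delta_mx 0 i) g z) 0 j| <= e.
  have := @filter_forall _ ('I_n * 'I_n)%type
    (fun ij z => `|('D_(delta_mx 0 ij.1) g z) 0 ij.2| <= e) (nbhs z0) (nbhs_filter z0)
    (fun ij => Dg ij.1 ij.2).
  by move: Unear; apply: filterS2 => z Uz Dz; split=> // i j; exact: (Dz (i, j)).
move=> /nbhs_ballP[r /= r0 rP]; exists r => //.
have {}rP z : `|z - z0| < r -> U z /\ forall i j,
    `|('D_(delta_mx 0 i) g z) 0 j| <= e.
  by move=> zr; apply: rP; rewrite -ball_normE /= distrC.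
have Dbound z : `|z - z0| < r -> forall w, `|'D_w g z| <= 2^-1 * `|w|.
  move=> zr w; have [Uz ez] := rP z zr.
  apply: rV_norm_le => [|j]; first by rewrite mulr_ge0.
  have -> : ('D_w g z) 0 j = \sum_i w 0 i * ('D_(delta_mx 0 i) g z) 0 j.
    rewrite (deriveEjacobian _ (gd z Uz)) mxE; apply: eq_bigr => i _.
    by rewrite -jacobianE//; exact: gd.
  apply: (le_trans (ler_norm_sum _ _ _)).
  apply: (@le_trans _ _ (\sum_(i < n) `|w| * e)).
    apply: ler_sum => i _; rewrite normrM ler_pM//; exact: rV_coord_norm.
  rewrite sumr_const card_ord -mulrnAr mulrC ler_wpM2r//.
  rewrite /e invfM -mulrnAr ler_piMr// -mulr_natr mulrC ler_pdivrMr// mul1r.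
  by rewrite ler_nat.
move=> z zr; have [Uz _] := rP z zr; split=> //; split; first exact: Dbound.
move=> z' z'r; apply: rV_norm_le => [|j]; first by rewrite mulr_ge0.
have seg t : 0 <= t <= 1 -> `|z' + t *: (z - z') - z0| < r.
  move=> /andP[t0 t1].
  have -> : z' + t *: (z - z') - z0 = (1 - t) *: (z' - z0) + t *: (z - z0).
    by rewrite !scalerBr !scalerBl !scale1r; apply/rowP => k; rewrite !mxE; ring.
  rewrite (le_lt_trans (ler_normD _ _))// !normrZ (ger0_norm t0) ger0_norm ?subr_ge0//.
  have [t1'|t1'] := ltP t 1.
    have : (1 - t) * `|z' - z0| < (1 - t) * r by rewrite ltr_pM2l ?subr_gt0.
    have : t * `|z - z0| <= t * r by rewrite ler_wpM2l// ltW.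
    lra.
  have -> : t = 1 by apply/eqP; rewrite eq_le t1 t1'.
  by rewrite subrr mul0r add0r mul1r.
have gdj t : 0 <= t <= 1 ->
    differentiable (fun y => g y 0 j) (z' + t *: (z - z')).
  move=> t01; apply: ((differentiable_rVP _ _).1 _ j); apply: gd.
  by have [] := rP _ (seg t t01).
have [t /andP[t0 t1]] := mean_value gdj.
have t01 : 0 <= t <= 1 by rewrite !ltW.
have -> : z' + (z - z') = z by rewrite addrC subrK.
move=> E; have [Uzt _] := rP _ (seg t t01).
rewrite !mxE E -derive_rV; last exact: gd.
exact: le_trans (rV_coord_norm _ _) (Dbound _ (seg t t01) _).
Qed.

(** Put h = phi (y + k) - phi y and J for the Jacobian matrix. Then k = f (phi y + h) - f (phi y),
    so h - k B = - (k - h J) B is o(|h|). The Lipschitz bound on [phi] turns this into o(|k|). *)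
Lemma differentiable_inverse f (phi : 'rV[R]_n -> 'rV[R]_n) y (K : R) :
  differentiable f (phi y) -> 'J f (phi y) \in unitmx ->
  (\forall k \near 0, f (phi (k + y)) = k + y) -> f (phi y) = y ->
  (\forall k \near 0, `|phi (k + y) - phi y| <= K * `|k|) ->
  differentiable phi y /\ forall v, 'D_v phi y = v *m invmx ('J f (phi y)).
Proof.
set B := invmx _ => fd Ju fphi fphiy lip.
have [L [Lc Lf]] := (differentiableP_eps _ _).1 fd.
have LE h : L h = h *m 'J f (phi y).
  suff <- : 'd f (phi y) = L :> ('rV[R]_n -> 'rV[R]_n).
    by rewrite -deriveEjacobian// deriveE.
  apply: diff_unique => //; apply/eqaddoP => e' e'0; apply: filterS (Lf e' e'0) => h'.
  by rewrite /= opprD addrA.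
have [KB KB0 HB] := mulmx_lipschitz B.
have Bd : forall e : R, 0 < e ->
    \forall k \near 0, `|phi (k + y) - phi y - mulmxr B k| <= e * `|k|.
  move=> e e0; pose K1 := `|K| + 1.
  have K10 : 0 < K1 by rewrite ltr_wpDl.
  have e1 : 0 < e / (KB * K1) by rewrite divr_gt0// mulr_gt0.
  have /nbhs_ballP[r /= r0 rP] := Lf _ e1.
  have near_r : \forall k \near (0 : 'rV[R]_n), `|k| < r / K1.
    apply/nbhs_ballP; exists (r / K1) => /=; first by rewrite divr_gt0.
    by move=> k; rewrite -ball_normE /= sub0r normrN.
  move: fphi lip near_r; apply: filterS3 => k fk lk kr.
  pose h := phi (k + y) - phi y.
  have hk : `|h| <= K1 * `|k|.
    apply: (le_trans lk); rewrite ler_wpM2r// /K1.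
    by have := ler_norm K; lra.
  have hr : ball (0 : 'rV[R]_n) r h.
    rewrite -ball_normE /= sub0r normrN (le_lt_trans hk)//.
    by rewrite mulrC -ltr_pdivlMr.
  have := rP h hr; rewrite {1}/h subrK fk fphiy addrK LE => hle.
  have -> : h - mulmxr B k = - ((k - h *m 'J f (phi y)) *m B).
    by rewrite mulmxBl -mulmxA mulmxV// mulmx1 opprB.
  rewrite normrN (le_trans (HB _))//.
  apply: (@le_trans _ _ (KB * (e / (KB * K1) * (K1 * `|k|)))).
    rewrite ler_pM2l// (le_trans hle)// ler_pM2l//.
  rewrite le_eqVlt; apply/orP; left; apply/eqP; field.
  by rewrite !gt_eqF.
have phid : differentiable phi y.
  apply/differentiableP_eps; exists (mulmxr B); split=> //.
  exact: mulmx_continuous.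
split=> // v; rewrite deriveE//.
have -> : 'd phi y = mulmxr B :> ('rV[R]_n -> 'rV[R]_n).
  apply: diff_unique; first exact: mulmx_continuous.
  apply/eqaddoP => e' e'0; apply: filterS (Bd e' e'0) => h'.
  by rewrite /= opprD addrA.
by [].
Qed.

(** Bootstrap: the derivative of [phi] is the inverse Jacobian matrix evaluated along [phi], so it
    has as many derivatives as [phi], and [phi] gains one order. *)
Lemma smooth_inverse f (phi : 'rV[R]_n -> 'rV[R]_n) (W V : set 'rV[R]_n) (K : R) :
  open W -> open V -> smooth_on W f -> (forall y, V y -> W (phi y)) ->
  (forall z, W z -> 'J f z \in unitmx) ->
  (forall y, V y -> f (phi y) = y) ->
  (forall y y', V y -> V y' -> `|phi y - phi y'| <= K * `|y - y'|) ->
  smooth_on V phi.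
Proof.
move=> oW oV /smooth_onP fW phiW Ju fphi lip; apply/smooth_onP.
have fd z : W z -> differentiable f z by exact: (Cn_differentiable (fW 0)).
have Vnear y : V y -> \forall k \near 0, V (k + y).
  move=> Vy; have : \forall z \near y, V z by exact: open_nbhs_nbhs.
  by rewrite (near_shift 0) /=; apply: filterS => h; rewrite subr0.
have phid y : V y ->
    differentiable phi y /\ forall v, 'D_v phi y = v *m invmx ('J f (phi y)).
  move=> Vy; apply: (@differentiable_inverse f phi y K).
  - exact/fd/phiW.
  - exact/Ju/phiW.
  - by apply: filterS (Vnear y Vy) => k; exact: fphi.
  - exact: fphi.
  - by apply: filterS (Vnear y Vy) => k Vk; have := lip _ _ Vk Vy; rewrite addrK.
elim=> [|k IH]; first by move=> [|//] y _ /phid[].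
apply/CnS; split=> [y /phid[]//|v].
have : Cn k V (fun y => v *m invmx ('J f (phi y))).
  apply/Cn_rVP => // j.
  have : Cn k V (fun y => \sum_i v 0 i * invmx ('J f (phi y)) i j).
    apply: Cn_sum => // i _; apply: (CnM oV (@Cn_cst _ _ _ k V (v 0 i))).
    apply: Cn_invmx => // [y Vy|i' j']; first exact/Ju/phiW.
    have [_ /(_ (delta_mx 0 i')) fS] := (CnS _ _ _).1 (fW k.+1).
    have := Cn_comp oV phiW IH ((Cn_rVP _ _ oW).1 fS j').
    by apply: Cn_ext => // y Vy; rewrite jacobianE//; exact/fd/phiW.
  by apply: Cn_ext => // y _; rewrite mxE.
by apply: Cn_ext => // y Vy; have [_ ->] := phid y Vy.
Qed.

Theorem inverse_function U f z0 :
  open U -> U z0 -> smooth_on U f -> (forall w, 'D_w f z0 = 0 -> w = 0) ->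
  exists (W V : set 'rV[R]_n) (phi : 'rV[R]_n -> 'rV[R]_n),
    [/\ open W, W z0, W `<=` U & open V] /\
    [/\ forall z, W z -> V (f z), forall y, V y -> W (phi y),
        forall z, W z -> phi (f z) = z, forall y, V y -> f (phi y) = y &
        smooth_on V phi].
Proof.
move=> oU Uz0 fU f0; have /smooth_onP fk := fU.
have fd z : U z -> differentiable f z by exact: (Cn_differentiable (fk 0)).
have J0 := jacobian_unit (fd _ Uz0) f0; set B := invmx ('J f z0).
(* The differential of [g] vanishes at [z0], and f z = y holds exactly when z is a fixed point of z
   |-> g z + y B, as B is invertible. *)
pose g z := z + f z *m (- B).
have gU : Cn 2 U g by apply: CnD => //; [exact: Cn_id|exact: Cn_mulmx].
have gE z w : U z -> 'D_w g z = w - 'D_w f z *m B.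
  move=> Uz; rewrite deriveD.
  - by rewrite derive_id derive_mulmx ?mulmxN//; exact: fd.
  - exact: derivable_id.
  - exact/diff_derivable/(Cn_differentiable (Cn_mulmx _ oU (fk 0)) Uz).
have [r r0 rP] : exists2 r : R, 0 < r & forall z, `|z - z0| < r -> U z /\
    (forall w, `|'D_w g z| <= 2^-1 * `|w|) /\
    (forall z', `|z' - z0| < r -> `|g z - g z'| <= 2^-1 * `|z - z'|).
  apply: (contraction_near_critical oU Uz0 gU) => w.
  by rewrite gE// deriveEjacobian ?mulmxK ?subrr//; exact: fd.
have gfE z z' : z - z' = (g z - g z') + (f z - f z') *m B.
  rewrite /g !mulmxN mulmxBl; apply/rowP => i; rewrite !mxE; ring.
have [K K0 BK] := mulmx_lipschitz B.
(* Since [g] contracts by 1/2, half of |z - z'| is left for the term in [f]. This yields both the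
   injectivity of [f] and the Lipschitz bound for its inverse. *)
have expand z z' : `|z - z0| < r -> `|z' - z0| < r ->
    `|z - z'| <= 2 * `|(f z - f z') *m B|.
  move=> zr z'r; have [_ [_ /(_ z' z'r)]] := rP z zr.
  have := ler_normD (g z - g z') ((f z - f z') *m B); rewrite -gfE; lra.
(* On the closed ball of radius r / 2 the contraction moves points by at most r / 4. With a shift
   below r / 4 the ball is mapped into itself. *)
pose V := [set y : 'rV[R]_n | `|(y - f z0) *m B| < r / 4].
have oV : open V.
  have -> : V = (fun y => y *m B) @^-1` (ball (f z0 *m B) (r / 4)).
    by apply/funext => y; rewrite /V /= -ball_normE /= distrC -mulmxBl.
  apply: open_comp; last exact: ball_open.
  by move=> y _; exact: mulmx_continuous.
pose W := [set z : 'rV[R]_n | `|z - z0| < r /\ V (f z)].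
have oW : open W.
  rewrite openE => z [zr Vfz]; apply: filterI.
    apply/nbhs_ballP; exists (r - `|z - z0|) => /=; first by rewrite subr_gt0.
    move=> z'; rewrite -ball_normE /= ltrBrDr distrC; apply: le_lt_trans.
    by rewrite -{1}(subrK z z') -addrA ler_normD.
  have : {for z, continuous f}.
    by apply: differentiable_continuous; apply: fd; have [] := rP z zr.
  by apply; exact: open_nbhs_nbhs.
have solve y : V y -> exists z, W z /\ f z = y.
  move=> Vy; pose D := [set z : 'rV[R]_n | `|z0 - z| <= r / 2].
  have Dr z : D z -> `|z - z0| < r.
    by rewrite /D /= distrC => /le_lt_trans; apply; rewrite ltr_pdivrMr// ltr_pMr// ltr1n.
  have TD : {homo (fun z => g z + y *m B) : z / D z >-> D z}.
    move=> z Dz; rewrite /D /=.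
    have -> : z0 - (g z + y *m B) = (g z0 - g z) - (y - f z0) *m B.
      by rewrite /g !mulmxN mulmxBl; apply/rowP => i; rewrite !mxE; ring.
    apply: (le_trans (ler_normB _ _)); move: Vy; rewrite /V /= => Vy.
    have [_ [_ /(_ z (Dr z Dz))]] := rP z0 ltac:(by rewrite subrr normr0).
    move: Dz; rewrite /D /=; lra.
  have ctr : is_contraction (mkfun_fun TD).
    have h0 : 0 <= (2^-1 : R) by rewrite invr_ge0.
    exists (NngNum h0); split=> /=; first by rewrite invf_lt1// ltr1n.
    move=> [z z'] [/= Dz Dz']; rewrite opprD addrACA subrr addr0.
    by have [_ [_]] := rP z (Dr z Dz); apply; exact: Dr.
  have cD : closed D by exact: closed_closed_ball_.
  have [|z Dz zE] := banach_fixed_point ctr cD.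
    by exists z0; rewrite /D /= subrr normr0 divr_ge0// ltW.
  have fz : f z = y.
    have : (f z - y) *m B = 0.
      have {}zE : z = z + f z *m (- B) + y *m B := zE.
      have -> : (f z - y) *m B = z - (z + f z *m (- B) + y *m B).
        by rewrite mulmxBl mulmxN; apply/rowP => i; rewrite !mxE; ring.
      by rewrite -zE subrr.
    move=> /(congr1 (mulmx^~ ('J f z0))); rewrite mulmxKV// mul0mx.
    by move/subr0_eq.
  by exists z; split=> //; split; [exact: Dr|rewrite fz].
have [phi phiP] : {phi : 'rV[R]_n -> 'rV[R]_n | forall y, V y -> W (phi y) /\ f (phi y) = y}.
  exists (fun y => if pselect (V y) is left Vy then projT1 (cid (solve y Vy)) else 0).
  by move=> y Vy; case: pselect => // Vy'; case: cid.
have phir y : V y -> `|phi y - z0| < r by move=> /phiP[[]].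
have WU : W `<=` U by move=> z [/rP[]].
exists W, V, phi; split.
  split=> //; split; first by rewrite subrr normr0.
  by rewrite /V /= subrr mul0mx normr0 divr_gt0.
split=> [z []//|y /phiP[]//|z [zr Vfz]|y /phiP[]//|].
  have [_ E] := phiP _ Vfz; apply/subr0_eq/eqP.
  by rewrite -normr_le0 (le_trans (expand _ _ (phir _ Vfz) zr))// E subrr mul0mx normr0 mulr0.
apply: (@smooth_inverse f phi W V (2 * K) oW oV).
- by apply/smooth_onP => k; exact: Cn_subset WU (fk k).
- by move=> y /phiP[].
(* If df kills [w], then dg fixes [w], which the bound 1/2 on dg allows only for w = 0. *)
- move=> z Wz; have Uz := WU z Wz; apply: jacobian_unit; first exact: fd.
  move=> w w0; case: Wz => zr _; have [_ [/(_ w) + _]] := rP z zr.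
  rewrite gE// w0 mul0mx subr0 => h; apply/eqP.
  by rewrite -normr_le0; lra.
- by move=> y /phiP[].
- move=> y y' Vy Vy'; apply: (le_trans (expand _ _ (phir _ Vy) (phir _ Vy'))).
  have [_ ->] := phiP _ Vy; have [_ ->] := phiP _ Vy'.
  by rewrite -mulrA ler_pM2l.
Qed.

End inverse_function_theorem.

(** * Local equations of an umbilical surface *)

Section derivative_rules.
Variables (R : realType) (X : normedModType R).
Implicit Types (f g : X -> R).

Lemma is_derive_add f g x v (df dg : R) : is_derive x v f df ->
  is_derive x v g dg -> is_derive x v (fun y => f y + g y) (df + dg).
Proof. exact: is_deriveD. Qed.

Lemma is_derive_mul f g x v (df dg : R) : is_derive x v f df ->
  is_derive x v g dg -> is_derive x v (fun y => f y * g y) (f x * dg + g x * df).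
Proof. exact: is_deriveM. Qed.

Lemma is_derive_opp f x v (df : R) : is_derive x v f df ->
  is_derive x v (fun y => - f y) (- df).
Proof. exact: is_deriveN. Qed.

Lemma is_derive_const (a : R) (x v : X) : is_derive x v (fun=> a) (0 : R).
Proof. exact: is_derive_cst. Qed.

Lemma is_derive_near_const (U : set X) f (a : R) x v (df : R) : open U -> U x ->
  (forall y, U y -> f y = a) -> is_derive x v f df -> df = 0.
Proof.
move=> oU Ux fa [_ <-]; rewrite -(derive_cst a x v); apply: near_eq_derive.
by near do rewrite fa//; exact: open_nbhs_nbhs.
Unshelve. all: by end_near. Qed.

Lemma is_derive_near_eq (U : set X) f g x v (df dg : R) : open U -> U x ->
  (forall y, U y -> f y = g y) -> is_derive x v f df -> is_derive x v g dg ->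
  df = dg.
Proof.
move=> oU Ux fg [_ <-] [_ <-]; apply: near_eq_derive.
by near do rewrite fg//; exact: open_nbhs_nbhs.
Unshelve. all: by end_near. Qed.

End derivative_rules.

Lemma is_derive_rV (R : realType) (X : normedModType R) (n : nat)
    (f : X -> 'rV[R]_n) x v i : differentiable f x ->
  is_derive x v (fun y => f y 0 i) (('D_v f x) 0 i).
Proof.
move=> fx; rewrite derive_rV//; apply: derivableP; apply: diff_derivable.
exact: ((differentiable_rVP _ _).1 fx).
Qed.

Lemma sum_I4 (V : nmodType) (F : 'I_4 -> V) :
  \sum_i F i = F 0 + F 1 + F 2 + F 3.
Proof.
rewrite !big_ord_recr big_ord0 /= add0r.
by congr (F _ + F _ + F _ + F _); apply/val_inj.
Qed.

Lemma forall_I4 (P : 'I_4 -> Prop) : P 0 -> P 1 -> P 2 -> P 3 -> forall i, P i.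
Proof.
move=> P0 P1 P2 P3 [[|[|[|[|//]]]] i].
- by have -> : Ordinal i = 0 by exact: val_inj.
- by have -> : Ordinal i = 1 by exact: val_inj.
- by have -> : Ordinal i = 2 by exact: val_inj.
- by have -> : Ordinal i = 3 by exact: val_inj.
Qed.

Lemma vec4E (R : realType) (a b c d : R) :
  (vec4 a b c d 0 0 = a) * (vec4 a b c d 0 1 = b) *
  (vec4 a b c d 0 2 = c) * (vec4 a b c d 0 3 = d).
Proof. by rewrite /vec4 !mxE. Qed.

Lemma dotE (R : realType) (v w : 'rV[R]_4) : dot v w =
  v 0 0 * w 0 0 + v 0 1 * w 0 1 + v 0 2 * w 0 2 + v 0 3 * w 0 3.
Proof. exact: sum_I4. Qed.

Lemma nuE (R : realType) (y : 'rV[R]_4) : (nu y 0 0 = y 0 0) * (nu y 0 1 = y 0 1) *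
  (nu y 0 2 = y 0 2) * (nu y 0 3 = 0).
Proof. by rewrite !vec4E. Qed.

Lemma derive_comm_rV (R : realType) (X : normedModType R) (n : nat) (U : set X)
    (g : X -> 'rV[R]_n) x v w i : open U -> U x -> Cn 2 U g ->
  'D_v (fun y => ('D_w g y) 0 i) x = 'D_w (fun y => ('D_v g y) 0 i) x.
Proof.
move=> oU Ux gU; have gi := (Cn_rVP 2 g oU).1 gU i.
have E v' w' : 'D_v' (fun y => ('D_w' g y) 0 i) x =
    'D_v' ('D_w' (fun y => g y 0 i)) x.
  apply: near_eq_derive; near=> y; rewrite derive_rV//.
  by apply: (Cn_differentiable gU); near: y; exact: open_nbhs_nbhs.
by rewrite !E; exact: derive_comm oU Ux gi.
Unshelve. all: by end_near. Qed.

(** The hypotheses on the surface read in a single chart, so that the local computations take place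
    on an open set of the plane. No regularity of [l] is included. *)
Record umbilical_patch (R : realType) (U : set 'rV[R]_2)
    (f N : 'rV[R]_2 -> 'rV[R]_4) (l : 'rV[R]_2 -> R) : Prop := UmbilicalPatch {
  patch_open : open U;
  patch_smooth : smooth_on U f;
  patch_normal_smooth : smooth_on U N;
  patch_range : forall z, U z -> S2xR (f z);
  patch_inj : forall z w, U z -> 'D_w f z = 0 -> w = 0;
  patch_tangent : forall z, U z -> tangent (f z) (N z);
  patch_unit : forall z, U z -> dot (N z) (N z) = 1;
  patch_orth : forall z w, U z -> dot (N z) ('D_w f z) = 0;
  patch_umbilical : forall z w, U z ->
    - ('D_w N z - dot ('D_w N z) (nu (f z)) *: nu (f z)) = l z *: 'D_w f z }.

Section umbilical_patch_theory.
Variables (R : realType) (U : set 'rV[R]_2) (f N : 'rV[R]_2 -> 'rV[R]_4)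
  (l : 'rV[R]_2 -> R).
Hypothesis hP : umbilical_patch U f N l.

Let oU := patch_open hP.
Let fU := patch_smooth hP.
Let NU := patch_normal_smooth hP.

Let fd z : U z -> differentiable f z.
Proof. by move/(fU [::]). Qed.

Let Nd z : U z -> differentiable N z.
Proof. by move/(NU [::]). Qed.

(** The component of dN along [nu] is found by differentiating <N, nu f> = 0 and then using <N, df>
    = 0: both sums run over the first three coordinates up to the term C dh. *)
Lemma derive_normal z w i : U z -> ('D_w N z) 0 i =
  - l z * ('D_w f z) 0 i + N z 0 3 * ('D_w f z) 0 3 * nu (f z) 0 i.
Proof.
move=> Uz; have := congr1 (fun v : 'rV[R]_4 => v 0 i) (patch_umbilical hP w Uz).
have nuEi : nu (f z) 0 i = [:: f z 0 0; f z 0 1; f z 0 2; 0]`_i by rewrite mxE.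
rewrite !mxE -nuEi => E.
suff S : dot ('D_w N z) (nu (f z)) = N z 0 3 * ('D_w f z) 0 3.
  by rewrite mulNr -E S; ring.
have := patch_orth hP w Uz; rewrite !dotE !vec4E => O.
have dx j := is_derive_rV w j (fd Uz); have dN j := is_derive_rV w j (Nd Uz).
have T y : U y -> N y 0 0 * f y 0 0 + N y 0 1 * f y 0 1 + N y 0 2 * f y 0 2 = 0.
  by move=> Uy; have := patch_tangent hP Uy; rewrite /tangent /= dotE !vec4E mulr0 addr0.
have := is_derive_add (is_derive_add (is_derive_mul (dN 0) (dx 0))
  (is_derive_mul (dN 1) (dx 1))) (is_derive_mul (dN 2) (dx 2)).
move/(is_derive_near_const oU Uz T); move: O; lra.
Qed.

Let is_derive_f z w i : U z ->
  is_derive z w (fun y => f y 0 i) (('D_w f z) 0 i).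
Proof. by move=> Uz; exact/is_derive_rV/fd. Qed.

Let is_derive_N z w i : U z ->
  is_derive z w (fun y => N y 0 i) (('D_w N z) 0 i).
Proof. by move=> Uz; exact/is_derive_rV/Nd. Qed.

Let is_derive_nu z w i : U z ->
  is_derive z w (fun y => nu (f y) 0 i) (nu ('D_w f z) 0 i).
Proof.
move=> Uz; move: i; apply: forall_I4; rewrite !nuE.
- have -> : (fun y => nu (f y) 0 0) = fun y => f y 0 0 by apply/funext => y; rewrite nuE.
  exact: is_derive_f.
- have -> : (fun y => nu (f y) 0 1) = fun y => f y 0 1 by apply/funext => y; rewrite nuE.
  exact: is_derive_f.
- have -> : (fun y => nu (f y) 0 2) = fun y => f y 0 2 by apply/funext => y; rewrite nuE.
  exact: is_derive_f.
- have -> : (fun y => nu (f y) 0 3) = cst 0 by apply/funext => y; rewrite nuE.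
  exact: is_derive_cst.
Qed.

Let differentiable_Df z w i : U z -> differentiable (fun y => ('D_w f y) 0 i) z.
Proof. by move=> Uz; exact: ((differentiable_rVP _ _).1 (fU [:: w] Uz)). Qed.

Let differentiable_DN z w i : U z -> differentiable (fun y => ('D_w N y) 0 i) z.
Proof. by move=> Uz; exact: ((differentiable_rVP _ _).1 (NU [:: w] Uz)). Qed.

Let differentiable_nu z i : U z -> differentiable (fun y => nu (f y) 0 i) z.
Proof.
move=> Uz; have fz j : differentiable (fun y => f y 0 j) z.
  exact: ((differentiable_rVP _ _).1 (fd Uz)).
move: i; apply: forall_I4.
- have -> : (fun y => nu (f y) 0 0) = fun y => f y 0 0 by apply/funext => y; rewrite nuE.
  exact: fz.
- have -> : (fun y => nu (f y) 0 1) = fun y => f y 0 1 by apply/funext => y; rewrite nuE.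
  exact: fz.
- have -> : (fun y => nu (f y) 0 2) = fun y => f y 0 2 by apply/funext => y; rewrite nuE.
  exact: fz.
- have -> : (fun y => nu (f y) 0 3) = cst 0 by apply/funext => y; rewrite nuE.
  exact: differentiable_cst.
Qed.

(** An immersion has some coordinate with nonzero derivative in a fixed direction; near the point,
    umbilicity in that coordinate expresses [l] as a quotient of differentiable functions. *)
Lemma differentiable_curvature z : U z -> differentiable l z.
Proof.
move=> Uz; pose w : 'rV[R]_2 := delta_mx 0 0.
have [i Di] : exists i, ('D_w f z) 0 i != 0.
  apply: contrapT => H; have : w = 0.
    apply: (patch_inj hP Uz); apply/rowP => i; rewrite [RHS]mxE; apply/eqP/negPn/negP => Hi.
    by apply: H; exists i.
  by move/rowP => /(_ 0) /eqP; rewrite !mxE eqxx oner_eq0.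
pose q y := (N y 0 3 * ('D_w f y) 0 3 * nu (f y) 0 i - ('D_w N y) 0 i)
  * (('D_w f y) 0 i)^-1.
have qd : differentiable q z.
  apply: differentiableM; last by apply: differentiableV => //; exact: differentiable_Df.
  apply: differentiableB; last exact: differentiable_DN.
  apply: differentiableM; last exact: differentiable_nu.
  apply: differentiableM; last exact: differentiable_Df.
  exact: ((differentiable_rVP _ _).1 (Nd Uz)).
apply: near_eq_differentiable qd.
have D0 : \forall y \near z, ('D_w f y) 0 i != 0.
  have := differentiable_continuous (differentiable_Df w i Uz).
  by move=> /cvgr_neq0; apply.
have Unear : \forall y \near z, U y by exact: open_nbhs_nbhs.
near=> y; have Uy : U y by near: y.
have Dy : ('D_w f y) 0 i != 0 by near: y.
rewrite /q derive_normal//; set a := _ * nu _ 0 i.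
set b := ('D_w f y) 0 i in Dy *.
have -> : a - (- l y * b + a) = l y * b by ring.
by rewrite mulfK.
Unshelve. all: by end_near. Qed.

(** The second derivatives of [f] enter as parameters [d3] and [di], so that the expansions in the
    two orders of [v] and [w] can share them and they cancel on subtraction. *)
Let second_derivative_normal z v w i (d3 di : R) : U z ->
  'D_v (fun y => ('D_w f y) 0 3) z = d3 ->
  'D_v (fun y => ('D_w f y) 0 i) z = di ->
  'D_v (fun y => ('D_w N y) 0 i) z =
  - 'D_v l z * ('D_w f z) 0 i - l z * di
  - l z * ('D_v f z) 0 3 * ('D_w f z) 0 3 * nu (f z) 0 i
  + N z 0 3 * d3 * nu (f z) 0 i
  + N z 0 3 * ('D_w f z) 0 3 * nu ('D_v f z) 0 i.
Proof.
move=> Uz d3E diE.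
have dl : is_derive z v l ('D_v l z).
  by apply/derivableP/diff_derivable/differentiable_curvature.
have dD3 : is_derive z v (fun y => ('D_w f y) 0 3) d3.
  by rewrite -d3E; apply/derivableP/diff_derivable/differentiable_Df.
have dDi : is_derive z v (fun y => ('D_w f y) 0 i) di.
  by rewrite -diE; apply/derivableP/diff_derivable/differentiable_Df.
have dDN : is_derive z v (fun y => ('D_w N y) 0 i)
    ('D_v (fun y => ('D_w N y) 0 i) z).
  by apply/derivableP/diff_derivable/differentiable_DN.
have := is_derive_add (is_derive_mul (is_derive_opp dl) dDi)
  (is_derive_mul (is_derive_mul (is_derive_N v 3 Uz) dD3)
     (is_derive_nu v i Uz)).
move/(is_derive_near_eq oU Uz (fun y Uy => derive_normal w i Uy) dDN) => ->.
by rewrite derive_normal// nuE; ring.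
Qed.

(* The Codazzi equation: the one-form al = d lambda + C dh satisfies
   al(w) df(v) = al(v) df(w), hence vanishes since df is injective. *)
Lemma derive_curvature z w : U z ->
  'D_w l z = - N z 0 3 * ('D_w f z) 0 3.
Proof.
move=> Uz.
have [al alE] : exists al, forall v, al v = 'D_v l z + N z 0 3 * ('D_v f z) 0 3.
  by eexists=> v; reflexivity.
have codazzi v v' i : al v' * ('D_v f z) 0 i = al v * ('D_v' f z) 0 i.
  have fC k := @derive_comm_rV _ _ _ U f z v v' k oU Uz ((smooth_onP _ _).1 fU 2%N).
  have NC := @derive_comm_rV _ _ _ U N z v v' i oU Uz ((smooth_onP _ _).1 NU 2%N).
  have E1 := second_derivative_normal Uz (fC 3) (fC i).
  have E2 := second_derivative_normal Uz (erefl ('D_v' (fun y => ('D_v f y) 0 3) z))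
    (erefl ('D_v' (fun y => ('D_v f y) 0 i) z)).
  have := etrans (esym E1) (etrans NC E2).
  rewrite !alE; move: {fC NC E1 E2} i ('D_v' (fun y => ('D_v f y) 0 i) z)
    ('D_v' (fun y => ('D_v f y) 0 3) z) ('D_v l z) ('D_v' l z)
    ('D_v f z) ('D_v' f z) (f z) (N z 0 3) (l z).
  move=> i di d3 a a' d d' x c k; move: i di.
  by apply: forall_I4 => di; rewrite !nuE; lra.
have dir v v' : al v' *: v = al v *: v'.
  apply/subr0_eq/(patch_inj hP Uz); rewrite -scaleNr.
  rewrite derive_dirD ?derive_scaler; try exact: fd.
  move: ('D_v f z) ('D_v' f z) (codazzi v v') => d d' H.
  by apply/rowP => i; rewrite !mxE H; ring.
(* Here dimension two is used: the independence of the two basis directions forces [al] to vanish on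
   the first one, and comparison with that one then gives every [w]. *)
have al0 : al (delta_mx 0 0) = 0.
  have := dir (delta_mx 0 1) (delta_mx 0 0) => /rowP /(_ 1).
  by rewrite !mxE /= mulr1 mulr0.
have := dir (delta_mx 0 0) w; rewrite al0 scale0r => /rowP /(_ 0).
by rewrite !mxE eqxx mulr1 alE => /eqP; rewrite addr_eq0 mulNr => /eqP.
Qed.

Lemma derive_angle z w : U z -> ('D_w N z) 0 3 = - l z * ('D_w f z) 0 3.
Proof. by move=> Uz; rewrite derive_normal// nuE mulr0 addr0. Qed.

Let is_derive_l z w : U z -> is_derive z w l (- N z 0 3 * ('D_w f z) 0 3).
Proof.
move=> Uz; rewrite -derive_curvature//; apply/derivableP/diff_derivable.
exact: differentiable_curvature.
Qed.

Let differentiable_f z i : U z -> differentiable (fun y => f y 0 i) z.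
Proof. by move=> Uz; exact: ((differentiable_rVP _ _).1 (fd Uz)). Qed.

Let differentiable_N z i : U z -> differentiable (fun y => N y 0 i) z.
Proof. by move=> Uz; exact: ((differentiable_rVP _ _).1 (Nd Uz)). Qed.

Lemma derive_range z w : U z -> dot ('D_w f z) (nu (f z)) = 0.
Proof.
move=> Uz; have dx j := is_derive_f w j Uz.
have := is_derive_add (is_derive_add (is_derive_mul (dx 0) (dx 0))
  (is_derive_mul (dx 1) (dx 1))) (is_derive_mul (dx 2) (dx 2)).
have T y : U y -> f y 0 0 * f y 0 0 + f y 0 1 * f y 0 1 + f y 0 2 * f y 0 2 = 1.
  by move=> Uy; have := patch_range hP Uy.
move/(is_derive_near_const oU Uz T); rewrite dotE !nuE.
move: ('D_w f z) (f z) => d x; lra.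
Qed.

Lemma invariant_vector z (i : 'I_4) : (i < 3)%N -> U z ->
  differentiable (fun y => l y * f y 0 i + N y 0 i) z /\
  forall w, 'D_w (fun y => l y * f y 0 i + N y 0 i) z = 0.
Proof.
move=> i3 Uz; split.
  apply: differentiableD; last exact: differentiable_N.
  by apply: differentiableM; [exact: differentiable_curvature|exact: differentiable_f].
move=> w; have [_ ->] := is_derive_add
  (is_derive_mul (is_derive_l w Uz) (is_derive_f w i Uz)) (is_derive_N w i Uz).
rewrite derive_normal//.
have -> : nu (f z) 0 i = f z 0 i.
  by move: i i3; apply: forall_I4; rewrite ?nuE.
by move: ('D_w f z) => d; ring.
Qed.

(** With s = 1 or s = -1, the formulas for d lambda and dC combine to d(lambda + s C) = - s (lambda
    + s C) dh, which the derivative of the exponential factor compensates. *)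
Lemma invariant_exp z (s : R) : s * s = 1 -> U z ->
  differentiable (fun y => expR (s * f y 0 3) * (l y + s * N y 0 3)) z /\
  forall w, 'D_w (fun y => expR (s * f y 0 3) * (l y + s * N y 0 3)) z = 0.
Proof.
move=> ss Uz.
have sf : differentiable (fun y => s * f y 0 3) z.
  by apply: differentiableM; [exact: differentiable_cst|exact: differentiable_f].
have [ed eE] := derive_comp1 0 sf (is_derive_expR _).
have gd : differentiable (fun y => l y + s * N y 0 3) z.
  apply: differentiableD; first exact: differentiable_curvature.
  by apply: differentiableM; [exact: differentiable_cst|exact: differentiable_N].
split; first exact: differentiableM.
move=> w; have {ed} [ed eDE] := derive_comp1 w sf (is_derive_expR _).
have dsf : 'D_w (fun y => s * f y 0 3) z = s * ('D_w f z) 0 3.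
  have [_ ->] := is_derive_mul (is_derive_const s z w) (is_derive_f w 3 Uz).
  by rewrite mulr0 addr0.
have de : is_derive z w (fun y => expR (s * f y 0 3))
    (s * ('D_w f z) 0 3 * expR (s * f z 0 3)).
  by rewrite -dsf -eDE; apply/derivableP/diff_derivable.
have [_ ->] := is_derive_mul de (is_derive_add (is_derive_l w Uz)
  (is_derive_mul (is_derive_const s z w) (is_derive_N w 3 Uz))).
rewrite derive_angle// mulr0 addr0.
move: ('D_w f z) (expR _) => d e.
transitivity (e * d 0 3 * N z 0 3 * (s * s - 1)); first by ring.
by rewrite ss subrr mulr0.
Qed.

Lemma derive_injE z w : U z -> (forall i, ('D_w f z) 0 i = 0) -> w = 0.
Proof.
move=> Uz w0; apply: (patch_inj hP Uz); apply/rowP => i.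
by rewrite w0 [RHS]mxE.
Qed.

End umbilical_patch_theory.

(** * Orthogonal frames and isometries *)

Section orthogonal_frames.
Variable R : realType.
Implicit Types x n y v w : 'rV[R]_4.

Lemma dot_mulmx v w : dot v w = (v *m w^T) 0 0.
Proof. by rewrite mxE; apply: eq_bigr => i _; rewrite mxE. Qed.

Lemma dot_orthogonal (Q : 'M[R]_4) v w : Q *m Q^T = 1%:M ->
  dot (v *m Q) (w *m Q) = dot v w.
Proof. by move=> QQ; rewrite !dot_mulmx trmx_mul mulmxA -(mulmxA v) QQ mulmx1. Qed.

Lemma S2xR_dot y : S2xR y <-> dot y y - y 0 3 ^+ 2 = 1.
Proof. by rewrite /S2xR /= dotE -!expr2 addrK. Qed.

Lemma isometry_orthogonal (Q : 'M[R]_4) : Q *m Q^T = 1%:M ->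
  (forall y, (y *m Q) 0 3 = y 0 3) -> isometry_S2xR (fun y => y *m Q).
Proof.
move=> QQ Q3; have QtQ : Q^T *m Q = 1%:M by exact: mulmx1C.
have Q3t y : (y *m Q^T) 0 3 = y 0 3 by rewrite -(Q3 (y *m Q^T)) -mulmxA QtQ mulmx1.
split.
  split=> [y /S2xR_dot Sy|y y' _ _ E|y Sy].
  - by apply/S2xR_dot; rewrite dot_orthogonal// Q3.
  - by rewrite -(mulmx1 y) -QQ mulmxA E -mulmxA QQ mulmx1.
  - exists (y *m Q^T); last by rewrite -mulmxA QtQ mulmx1.
    by apply/S2xR_dot; rewrite dot_orthogonal ?trmxK// Q3t; exact/S2xR_dot.
move=> y Sy; exists setT, (fun y => y *m Q); have oT : open [set: 'rV[R]_4] by exact: openT.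
split=> //.
  by apply/smooth_onP => k; apply: Cn_mulmx => //; exact: Cn_id.
move=> v w _ _; have idd : differentiable (id : 'rV[R]_4 -> 'rV[R]_4) y.
  exact: (Cn_differentiable (@Cn_id _ _ 0 _ oT) (I : setT y)).
by rewrite !derive_mulmx// !derive_id dot_orthogonal.
Qed.

Definition cross x n : 'rV[R]_4 :=
  vec4 (x 0 1 * n 0 2 - x 0 2 * n 0 1) (x 0 2 * n 0 0 - x 0 0 * n 0 2)
       (x 0 0 * n 0 1 - x 0 1 * n 0 0) 0.

Definition frame x n : 'M[R]_4 :=
  \matrix_(i, j) ([:: nu x; nu n; cross x n; e3 R]`_i) 0 j.

Lemma frameE x n y : y *m (frame x n)^T =
  vec4 (dot y (nu x)) (dot y (nu n)) (dot y (cross x n)) (y 0 3).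
Proof.
apply/rowP; apply: forall_I4; rewrite !vec4E mxE /dot.
- by apply: eq_bigr => j _; rewrite !mxE.
- by apply: eq_bigr => j _; rewrite !mxE.
- by apply: eq_bigr => j _; rewrite !mxE.
- by rewrite sum_I4 !mxE /= !mulr0 mulr1 !add0r.
Qed.

Lemma frame_orthogonal x n : dot x (nu x) = 1 -> dot n (nu n) = 1 ->
  dot x (nu n) = 0 -> frame x n *m (frame x n)^T = 1%:M.
Proof.
rewrite !dotE !nuE !mulr0 !addr0 => xx nn xn.
have r0 : row 0 (frame x n) = nu x by apply/rowP => j; rewrite !mxE.
have r1 : row 1 (frame x n) = nu n by apply/rowP => j; rewrite !mxE.
have r2 : row 2 (frame x n) = cross x n by apply/rowP => j; rewrite !mxE.
have r3 : row 3 (frame x n) = e3 R by apply/rowP => j; rewrite !mxE.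
suff H : forall i, row i (frame x n) *m (frame x n)^T = delta_mx 0 i.
  by apply/row_matrixP => i; rewrite row_mul H row1.
apply: forall_I4; rewrite ?r0 ?r1 ?r2 ?r3 frameE; apply/rowP; apply: forall_I4;
  rewrite !vec4E ?dotE ?nuE ?vec4E [RHS]mxE /= ?mulr0 ?addr0 //.
all: try lra.
(* Lagrange's identity |x|^2 |n|^2 - <x, n>^2 = |x cross n|^2 gives the length of the third row. *)
have <- : (x 0 0 * x 0 0 + x 0 1 * x 0 1 + x 0 2 * x 0 2) *
    (n 0 0 * n 0 0 + n 0 1 * n 0 1 + n 0 2 * n 0 2)
    - (x 0 0 * n 0 0 + x 0 1 * n 0 1 + x 0 2 * n 0 2) ^+ 2 = 1.
  by rewrite xx nn xn; ring.
by ring.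
Qed.

End orthogonal_frames.

Section height.
Variables (R : realType) (U : set 'rV[R]_2) (f N : 'rV[R]_2 -> 'rV[R]_4)
  (l : 'rV[R]_2 -> R).
Hypothesis hP : umbilical_patch U f N l.

(* If e3 is tangent to S^2 x R and normal to the surface, both tangent
   directions lie on the line orthogonal to x and n in R^3. *)
Lemma height_derive_neq0 z : U z -> N z 0 3 = 0 ->
  exists w, ('D_w f z) 0 3 != 0.
Proof.
move=> Uz N3; apply: contrapT => H.
have D3 w : ('D_w f z) 0 3 = 0.
  by apply/eqP/negPn/negP => Dw; apply: H; exists w.
have fd : differentiable f z by exact: (patch_smooth hP [::]).
pose F := frame (f z) (N z).
have FF : F *m F^T = 1%:M.
  apply: frame_orthogonal; rewrite dotE !nuE mulr0 addr0.
  - exact: patch_range hP z Uz.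
  - by have := patch_unit hP Uz; rewrite dotE N3 mulr0 addr0.
  - by have := patch_tangent hP Uz; rewrite /tangent /= dotE !nuE; lra.
pose T w := dot ('D_w f z) (cross (f z) (N z)).
have TE w : 'D_w f z = T w *: row 2 F.
  rewrite -[LHS](mulmx1) -(mulmx1C FF) mulmxA frameE D3.
  have -> : dot ('D_w f z) (nu (f z)) = 0 by exact: derive_range hP _ _ Uz.
  have -> : dot ('D_w f z) (nu (N z)) = 0.
    by have := patch_orth hP w Uz; rewrite !dotE !nuE N3; move: ('D_w f z) => d; lra.
  rewrite -/(T w); apply/rowP => i; rewrite [LHS]mxE sum_I4 !vec4E !mxE; ring.
(* All values of df are multiples of one vector, so a nontrivial combination of two independent
   directions lies in the kernel of df unless both multiples vanish; injectivity excludes either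
   case. *)
pose u : 'rV[R]_2 := delta_mx 0 0; pose v : 'rV[R]_2 := delta_mx 0 1.
have : T v *: u - T u *: v = 0.
  apply: (patch_inj hP Uz); rewrite -scaleNr derive_dirD// !derive_scaler//.
  by rewrite (TE u) (TE v) !scalerA mulNr mulrC -scalerDl subrr scale0r.
move/rowP => /(_ 1); rewrite !mxE /= mulr0 mulr1 sub0r => /eqP.
rewrite oppr_eq0 => /eqP Tu.
have : u = 0 by apply: (patch_inj hP Uz); rewrite TE Tu scale0r.
by move/rowP => /(_ 0) /eqP; rewrite !mxE eqxx oner_eq0.
Qed.

End height.

(** * Functions with vanishing differential on a connected surface *)

Section surface.
Variables (R : realType) (M : topologicalType).
Implicit Types (x y : chart R M) (A : set (chart R M)).

Lemma cmap_continuous x q : cdom x q -> {for q, continuous (cmap x)}.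
Proof.
move=> xq; have := @cmap_cont _ _ x.
by rewrite (continuous_open_subspace _ (@cdom_open _ _ x)); apply; rewrite inE.
Qed.

Lemma cinv_continuous x z : cimg x z -> {for z, continuous (cinv x)}.
Proof.
move=> xz; have := @cinv_cont _ _ x.
by rewrite (continuous_open_subspace _ (@cimg_open _ _ x)); apply; rewrite inE.
Qed.

Lemma constant_on_surface A (g : M -> R) : oriented_surface A ->
  (forall x z, A x -> cimg x z -> differentiable (g \o cinv x) z /\
    forall w, 'D_w (g \o cinv x) z = 0) ->
  forall p q, g p = g q.
Proof.
move=> hM gd p q.
have loc r : \forall s \near r, g s = g r.
  have [x Ax xr] := surface_cover hM r; have zr := cmap_img xr.
  have /nbhs_ballP[e /= e0 eP] : nbhs (cmap x r) (cimg x).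
    by apply: open_nbhs_nbhs; split=> //; exact: cimg_open.
  have H1 : \forall s \near r, cdom x s.
    by apply: open_nbhs_nbhs; split=> //; exact: cdom_open.
  have H2 : \forall s \near r, ball (cmap x r) e (cmap x s).
    by apply: (cmap_continuous xr); exact: nbhsx_ballx.
  move: H1 H2; apply: filterS2 => s xs; rewrite -ball_normE /= => se.
  pose v := cmap x s - cmap x r.
  have seg t : 0 <= t <= 1 -> cimg x (cmap x r + t *: v).
    move=> /andP[t0 t1]; apply: eP; rewrite -ball_normE /=.
    rewrite opprD addrA subrr sub0r normrN normrZ ger0_norm//.
    by rewrite (le_lt_trans _ se)// distrC ler_piMl.
  have [t /andP[t0 t1]] := mean_value (fun t t01 => (gd x _ Ax (seg t t01)).1).
  have t01 : 0 <= t <= 1 by rewrite !ltW.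
  have [_ ->] := gd x _ Ax (seg t t01).
  have -> : cmap x r + v = cmap x s by rewrite /v addrC subrK.
  by rewrite /= !cmapK// => /subr0_eq.
(* A locally constant function has open preimages of arbitrary sets, so a level set and its
   complement are both open and connectedness applies. *)
have openP (P : set R) : open [set r | P (g r)].
  rewrite openE => r Pr; rewrite /interior /=.
  by apply: filterS (loc r) => s /= ->.
suff : [set r | g r = g q] = setT.
  by move/seteqP => [_ /(_ p I)].
apply: (surface_connected hM).
- by exists q.
- by exists [set r | g r = g q]; [exact: (openP [set t | t = g q])|rewrite setTI].
- exists [set r | g r = g q]; last by rewrite setTI.
  rewrite -(setCK [set _ | _]); apply: open_closedC.
  exact: (openP [set t | t <> g q]).
Qed.

End surface.

(** * Global invariants of an umbilical surface *)

Lemma derive_at_min (R : realType) (X : normedModType R) (g : X -> R) z w :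
  (\forall y \near z, differentiable g y /\ g z <= g y) -> 'D_w g z = 0.
Proof.
move=> /nbhs_ballP[r /= r0 rP].
pose e := r / (`|w| + 1); have w1 : 0 < `|w| + 1 by rewrite ltr_wpDl.
have e0 : 0 < e by rewrite divr_gt0.
have eb t : t \in `](- e), e[ -> ball z r (z + t *: w).
  rewrite in_itv /= => te; rewrite -ball_normE /= opprD addrA subrr sub0r normrN.
  rewrite normrZ; apply: (@le_lt_trans _ _ (`|t| * (`|w| + 1))).
    by rewrite ler_wpM2l// lerDl.
  by rewrite -ltr_pdivlMr// ltr_norml.
have z0 : z + 0 *: w = z by rewrite scale0r addr0.
have [] := @derive1_at_min R (fun t => g (z + t *: w)) (- e) e 0 _ _ _ _.
- by rewrite ge0_cp// ltW.
- by move=> t te; have [] := is_derive_line (rP _ (eb t te)).1.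
- by rewrite in_itv /= oppr_lt0 e0.
- by move=> t te; rewrite z0; exact: (rP _ (eb t te)).2.
move=> _; have := @is_derive_line _ _ g z w 0; rewrite z0 => H.
by have [_ ->] := H (rP z (ballxx _ r0)).1.
Qed.

Section umbilical_surface.
Variables (R : realType) (M : topologicalType) (A : set (chart R M))
    (F xi : M -> 'rV[R]_4) (lambda : M -> R).
Hypotheses (hM : oriented_surface A) (hF : immersion A F)
    (hxi : unit_normal A F xi) (humb : totally_umbilical A F xi lambda)
    (hgeo : ~ totally_geodesic A F xi).

Lemma chart_patch x : A x -> umbilical_patch (cimg x)
  (F \o cinv x) (xi \o cinv x) (lambda \o cinv x).
Proof.
move=> Ax; have D f z w : cimg x z -> dmap x f (cinv x z) w = 'D_w (f \o cinv x) z.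
  by move=> xz; rewrite /dmap cinvK.
split=> [||||z w xz|z xz|z xz|z w xz|z w xz].
- exact: cimg_open.
- exact: (immersion_smooth hF).
- exact: (normal_smooth hxi).
- by move=> z _; exact: (immersion_range hF).
- by rewrite -D//; apply: (immersion_inj hF) => //; exact: cinv_dom.
- exact: (normal_tangent hxi).
- exact: (normal_unit hxi).
- by rewrite -D//; apply: (normal_orth hxi) => //; exact: cinv_dom.
- by have := humb w Ax (cinv_dom xz); rewrite /Defs.shape /nabla /dmap cinvK.
Qed.

Lemma umbilical_vector : exists a : 'rV[R]_4, forall p (i : 'I_4), (i < 3)%N ->
  lambda p * F p 0 i + xi p 0 i = a 0 i.
Proof.
(* A connected space may be empty here; then any vector serves. *)
have [p0|M0] := pselect (inhabited M); last first.
  by exists 0 => p; case: M0.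
case: p0 => p0; exists (lambda p0 *: F p0 + xi p0) => p i i3; rewrite !mxE.
pose g q := lambda q * F q 0 i + xi q 0 i.
suff : g p = g p0 by [].
apply: (constant_on_surface hM) => x z Ax xz.
exact: (invariant_vector (chart_patch Ax) i3 xz).
Qed.

Lemma umbilical_exp (s : R) p q : s * s = 1 ->
  expR (s * F p 0 3) * (lambda p + s * xi p 0 3) =
  expR (s * F q 0 3) * (lambda q + s * xi q 0 3).
Proof.
move=> ss; pose g r := expR (s * F r 0 3) * (lambda r + s * xi r 0 3).
suff : g p = g q by [].
apply: (constant_on_surface hM) => x z Ax xz.
exact: (invariant_exp (chart_patch Ax) ss xz).
Qed.

Lemma curvature_nonzero : ~ forall p, lambda p = 0.
Proof.
by move=> l0; apply: hgeo => x p w Ax xp; rewrite humb// l0.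
Qed.

Lemma curvature_angle_nonzero p : lambda p = 0 -> xi p 0 3 = 0 -> False.
Proof.
move=> l0 C0; apply: curvature_nonzero => q.
have H s : s * s = 1 -> lambda q + s * xi q 0 3 = 0.
  move=> ss; have := umbilical_exp p q ss; rewrite l0 C0 mulr0 addr0 mulr0.
  by move/esym/eqP; rewrite mulf_eq0 gt_eqF ?expR_gt0//= => /eqP.
have := H 1 (mulr1 1); have := H (- 1); rewrite mulrNN mulr1 => /(_ erefl); lra.
Qed.

Lemma normal_components p : xi p 0 0 * F p 0 0 + xi p 0 1 * F p 0 1
    + xi p 0 2 * F p 0 2 = 0 /\
  xi p 0 0 * xi p 0 0 + xi p 0 1 * xi p 0 1 + xi p 0 2 * xi p 0 2
    + xi p 0 3 * xi p 0 3 = 1.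
Proof.
have := normal_tangent hxi p; rewrite /tangent /= dotE !nuE mulr0 addr0 => ->.
by have := normal_unit hxi p; rewrite dotE.
Qed.

Lemma curvature_relation : exists (a : 'rV[R]_4) (c : R), [/\ 0 < c,
  forall p (i : 'I_4), (i < 3)%N -> lambda p * F p 0 i + xi p 0 i = a 0 i &
  forall p, lambda p ^+ 2 + 1 - xi p 0 3 ^+ 2 = c ^+ 2].
Proof.
have [a aP] := umbilical_vector.
pose c2 := a 0 0 ^+ 2 + a 0 1 ^+ 2 + a 0 2 ^+ 2.
have c2E p : lambda p ^+ 2 + 1 - xi p 0 3 ^+ 2 = c2.
  have [nx nn] := normal_components p; have xx := immersion_range hF p.
  rewrite /c2 -!(aP p)// -[X in _ + X - _]nn.
  transitivity (lambda p ^+ 2 * (F p 0 0 ^+ 2 + F p 0 1 ^+ 2 + F p 0 2 ^+ 2)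
    + 2 * lambda p * (xi p 0 0 * F p 0 0 + xi p 0 1 * F p 0 1 + xi p 0 2 * F p 0 2)
    + (xi p 0 0 ^+ 2 + xi p 0 1 ^+ 2 + xi p 0 2 ^+ 2)); last by ring.
  by rewrite xx nx; ring.
(* The identity [c2E] reads |a|^2 = lambda^2 + |n|^2, with n the first three coordinates of xi. If a
   were zero, lambda would vanish at every point. *)
have c20 : 0 < c2.
  have c2ge : 0 <= c2 by rewrite /c2 !addr_ge0 ?sqr_ge0.
  rewrite lt_neqAle c2ge andbT; apply/eqP => c0; apply: curvature_nonzero => p.
  have [_ nn] := normal_components p; have := c2E p; rewrite -c0 => E.
  apply/eqP; rewrite -sqrf_eq0; apply/eqP.
  have := sqr_ge0 (lambda p); have := sqr_ge0 (xi p 0 0); have := sqr_ge0 (xi p 0 1).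
  have := sqr_ge0 (xi p 0 2); rewrite !expr2 in E *; lra.
exists a, (Num.sqrt c2); split=> //; first by rewrite sqrtr_gt0.
by move=> p; rewrite c2E sqr_sqrtr// ltW.
Qed.

Lemma angle_bound p : -1 <= xi p 0 3 <= 1.
Proof.
have [_ nn] := normal_components p; rewrite -ler_norml -ler_sqr ?nnegrE// expr1n real_normK ?num_real//.
have := sqr_ge0 (xi p 0 0); have := sqr_ge0 (xi p 0 1).
by have := sqr_ge0 (xi p 0 2); rewrite !expr2; lra.
Qed.

Lemma angleE p : angle xi p = acos (xi p 0 3).
Proof. by rewrite /angle dotE /e3 !vec4E; congr acos; ring. Qed.

Lemma cos_angle p : cos (angle xi p) = xi p 0 3.
Proof. by rewrite angleE acosK// in_itv /= angle_bound. Qed.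

Lemma sin_angle p : sin (angle xi p) = Num.sqrt (1 - xi p 0 3 ^+ 2).
Proof. by rewrite angleE sin_acos// angle_bound. Qed.

(* The height has a nonzero derivative where C = 0, so dC = - lambda dh = 0
   would give lambda = C = 0. *)
Lemma angle_critical x z : A x -> cimg x z -> xi (cinv x z) 0 3 = 0 ->
  ~ forall w, 'D_w (fun y => xi (cinv x y) 0 3) z = 0.
Proof.
move=> Ax xz C0 DC; have hP := chart_patch Ax.
have [w Dw] := height_derive_neq0 hP xz C0.
have xid : differentiable (xi \o cinv x) z by exact: (patch_normal_smooth hP [::]).
have := derive_angle hP w xz; rewrite derive_rV// DC => /esym/eqP.
rewrite mulf_eq0 (negbTE Dw) orbF oppr_eq0 => /eqP l0.
exact: curvature_angle_nonzero l0 C0.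
Qed.

(** A locally constant C cannot be 0, by [angle_critical]. If it were 1 or -1, the spherical part n
    of xi would vanish nearby, so dn = 0 and orthogonality would give dh = 0. Umbilicity would leave
    lambda dx = 0 with lambda^2 = c^2 > 0, contradicting that F is an immersion. *)
Lemma cos_angle_near_const x z (a : R) : A x -> cimg x z ->
  (\forall y \near z, xi (cinv x y) 0 3 = a) ->
  xi (cinv x z) 0 3 != 0 /\ xi (cinv x z) 0 3 ^+ 2 != 1.
Proof.
move=> Ax xz Ca; have hP := chart_patch Ax; split.
  apply/eqP => C0; apply: (angle_critical Ax xz C0) => w.
  by rewrite -(derive_cst a z w); exact: near_eq_derive.
apply/eqP => C1.
have a1 : a ^+ 2 = 1 by rewrite -C1 -(nbhs_singleton Ca).
have n0 (i : 'I_4) : (i < 3)%N -> \forall y \near z, xi (cinv x y) 0 i = 0.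
  move=> i3; apply: filterS Ca => y Cy.
  have [_ nn] := normal_components (cinv x y).
  move: i i3; apply: forall_I4 => // _; apply/eqP; rewrite -sqrf_eq0; apply/eqP;
  move: nn a1; rewrite Cy; have := sqr_ge0 (xi (cinv x y) 0 0);
  have := sqr_ge0 (xi (cinv x y) 0 1); have := sqr_ge0 (xi (cinv x y) 0 2);
  rewrite !expr2; lra.
have xid : differentiable (xi \o cinv x) z by exact: (patch_normal_smooth hP [::]).
pose w : 'rV[R]_2 := delta_mx 0 0.
have Dn (i : 'I_4) : (i < 3)%N -> ('D_w (xi \o cinv x) z) 0 i = 0.
  by move=> i3; rewrite derive_rV// -(derive_cst (0 : R) z w); exact: near_eq_derive (n0 i i3).
have C0 : xi (cinv x z) 0 3 != 0.
  by apply/eqP => C0; move: C1; rewrite C0 expr0n /= => /esym/eqP; rewrite oner_eq0.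
have D3 : ('D_w (F \o cinv x) z) 0 3 = 0.
  have := patch_orth hP w xz; rewrite dotE /=.
  rewrite (nbhs_singleton (n0 0 isT)) (nbhs_singleton (n0 1 isT)) (nbhs_singleton (n0 2 isT)).
  by rewrite !mul0r !add0r => /eqP; rewrite mulf_eq0 (negbTE C0) => /eqP.
have [a' [c [c0 _ cE]]] := curvature_relation.
have l0 : lambda (cinv x z) != 0.
  apply/eqP => l0; have := cE (cinv x z); rewrite l0 C1 expr0n /= add0r subrr.
  by move/esym/eqP; rewrite sqrf_eq0 gt_eqF.
have : w = 0.
  apply: (derive_injE hP xz); apply: forall_I4 => //; apply/eqP.
  - have := derive_normal hP w 0 xz; rewrite D3 mulr0 mul0r addr0 Dn// => /esym/eqP.
    by rewrite mulf_eq0 oppr_eq0 (negbTE l0).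
  - have := derive_normal hP w 1 xz; rewrite D3 mulr0 mul0r addr0 Dn// => /esym/eqP.
    by rewrite mulf_eq0 oppr_eq0 (negbTE l0).
  - have := derive_normal hP w 2 xz; rewrite D3 mulr0 mul0r addr0 Dn// => /esym/eqP.
    by rewrite mulf_eq0 oppr_eq0 (negbTE l0).
by move/rowP => /(_ 0) /eqP; rewrite !mxE eqxx oner_eq0.
Qed.

Lemma dense_generic_angle : dense
  [set p | [/\ 0 < angle xi p, angle xi p < pi & angle xi p != pi / 2]].
Proof.
move=> O [q0 Oq0] oO; apply: contrapT => H.
have C3 q : O q -> xi q 0 3 * (xi q 0 3 ^+ 2 - 1) = 0.
  move=> Oq; apply: contrapT => Cq; apply: H; exists q; split=> //.
  have /andP[C1 C2] := angle_bound q.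
  have Cn1 : xi q 0 3 != -1 by apply/eqP => E; apply: Cq; rewrite E; ring.
  have C1' : xi q 0 3 != 1 by apply/eqP => E; apply: Cq; rewrite E; ring.
  have C0 : xi q 0 3 != 0 by apply/eqP => E; apply: Cq; rewrite E; ring.
  split; rewrite ?angleE.
  - by apply: acos_gt0; rewrite C1 lt_neqAle C1'.
  - by apply: acos_ltpi; rewrite C2 andbT lt_neqAle eq_sym Cn1.
  - apply/eqP => /(congr1 cos); rewrite cos_pihalf acosK ?in_itv/= ?C1//.
    by move/eqP; rewrite (negbTE C0).
have [x Ax xq0] := surface_cover hM q0; pose z0 := cmap x q0.
have xz0 : cimg x z0 by exact: cmap_img.
have qE : cinv x z0 = q0 by exact: cmapK.
have Onear : \forall y \near z0, O (cinv x y).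
  by apply: (cinv_continuous xz0); rewrite qE; exact: open_nbhs_nbhs.
have xid : differentiable (xi \o cinv x) z0.
  exact: (patch_normal_smooth (chart_patch Ax) [::]).
have Ccont := differentiable_continuous ((differentiable_rVP _ _).1 xid 3).
(* On [O] the only possible values of C are -1, 0 and 1. Two of them closer than 1 coincide, so
   continuity makes C locally constant. *)
have Cclose : \forall y \near z0, `|xi (cinv x z0) 0 3 - xi (cinv x y) 0 3| < 1.
  by move/cvgrPdist_lt : Ccont; apply.
have Cnear : \forall y \near z0, xi (cinv x y) 0 3 = xi (cinv x z0) 0 3.
  move: Onear Cclose; apply: filterS2 => y Oy; rewrite ltr_norml => /andP[].
  have := C3 _ Oy; have : O (cinv x z0) by rewrite qE.
  move=> /C3 /eqP; rewrite mulf_eq0 subr_eq0 sqrf_eq1.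
  move=> /or3P[]/eqP-> /eqP; rewrite mulf_eq0 subr_eq0 sqrf_eq1 => /or3P[]/eqP->; lra.
have [C0 C1] := cos_angle_near_const Ax xz0 Cnear.
have : O (cinv x z0) by rewrite qE.
move/C3/eqP; rewrite mulf_eq0 (negbTE C0) subr_eq0 (negbTE C1) //.
Qed.

(** The bound on the angle near [p] says that C is nonnegative there. A zero of C at [p] would be a
    local minimum, hence a critical point, which [angle_critical] forbids. *)
Lemma cos_angle_gt0 p : angle xi p != 0 ->
  (\forall q \near p, angle xi q <= pi / 2) -> 0 < xi p 0 3 < 1.
Proof.
move=> tp tnear; have /andP[C1 C2] := angle_bound p.
have Cnear : \forall q \near p, 0 <= xi q 0 3.
  apply: filterS tnear => q tq; rewrite -cos_angle; apply: cos_ge0_pihalf.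
  rewrite tq andbT; apply: (@le_trans _ _ 0); first by rewrite oppr_le0 divr_ge0// pi_ge0.
  by rewrite angleE acos_ge0// angle_bound.
apply/andP; split; last first.
  by rewrite lt_neqAle C2 andbT; apply: contraNneq tp => E; rewrite angleE E acos1.
rewrite lt_neqAle (nbhs_singleton Cnear) andbT eq_sym; apply/eqP => C0.
have [x Ax xp] := surface_cover hM p.
have xz : cimg x (cmap x p) by exact: cmap_img.
apply: (angle_critical Ax xz); first by rewrite cmapK.
move=> w; apply: derive_at_min; rewrite cmapK// C0.
have H1 : \forall y \near cmap x p, cimg x y.
  by apply: open_nbhs_nbhs; split=> //; exact: cimg_open.
have H2 : \forall y \near cmap x p, 0 <= xi (cinv x y) 0 3.
  have Cn : \forall q \near cinv x (cmap x p), 0 <= xi q 0 3 by rewrite cmapK.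
  exact: (cinv_continuous xz Cn).
move: H1 H2; apply: filterS2 => y xy Cy; split=> //.
apply: ((differentiable_rVP (xi \o cinv x) y).1 _ 3).
exact: (patch_normal_smooth (chart_patch Ax) [::]).
Qed.

End umbilical_surface.

(** * Adapted coordinates *)

Section change_of_coordinates.
Variables (R : realType) (M : topologicalType) (A : set (chart R M)).

Lemma transition_domain_open (x y : chart R M) :
  open (cmap x @` (cdom x `&` cdom y)).
Proof.
rewrite openE => _ [p [xp yp] <-]; have xz := cmap_img xp.
have H1 : \forall z \near cmap x p, cimg x z.
  by apply: open_nbhs_nbhs; split=> //; exact: cimg_open.
have H2 : \forall z \near cmap x p, cdom y (cinv x z).
  have yn : \forall q \near cinv x (cmap x p), cdom y q.
    by rewrite cmapK//; apply: open_nbhs_nbhs; split=> //; exact: cdom_open.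
  exact: (cinv_continuous xz yn).
move: H1 H2; apply: filterS2 => z xz' yz; exists (cinv x z); last exact: cinvK.
by split=> //; exact: cinv_dom.
Qed.

(** Both transition maps of the new chart factor through [y]: one is an old transition preceded by
    [phi], the other an old transition followed by [psi]. *)
Lemma change_coordinates (y : chart R M) (W V : set 'rV[R]_2)
    (psi phi : 'rV[R]_2 -> 'rV[R]_2) : oriented_surface A -> A y ->
  open W -> W `<=` cimg y -> open V ->
  (forall z, W z -> V (psi z)) -> (forall z, V z -> W (phi z)) ->
  (forall z, W z -> phi (psi z) = z) -> (forall z, V z -> psi (phi z) = z) ->
  smooth_on W psi -> smooth_on V phi ->
  exists x : chart R M, [/\ local_coordinates A x,
    forall q, cdom x q <-> cdom y q /\ W (cmap y q) &
    forall q, cmap x q = psi (cmap y q)].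
Proof.
move=> hM Ay oW Wy oV psiV phiW phiK psiK psis phis.
have psic z : W z -> {for z, continuous psi}.
  by move=> Wz; apply: differentiable_continuous; exact: (psis [::]).
have phic z : V z -> {for z, continuous phi}.
  by move=> Vz; apply: differentiable_continuous; exact: (phis [::]).
pose D := cdom y `&` cmap y @^-1` W.
have oD : open D.
  rewrite openE => q [yq Wq]; apply: filterI.
    by apply: open_nbhs_nbhs; split=> //; exact: cdom_open.
  by apply: (cmap_continuous yq); exact: open_nbhs_nbhs.
have mD q : D q -> V (psi (cmap y q)) by move=> [_]; exact: psiV.
have iV z : V z -> D (cinv y (phi z)).
  move=> Vz; have Wz := phiW z Vz; split; first exact/cinv_dom/Wy.
  by rewrite /= cinvK//; exact: Wy.
have mK q : D q -> cinv y (phi (psi (cmap y q))) = q.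
  by move=> [yq Wq]; rewrite phiK// cmapK.
have iK z : V z -> psi (cmap y (cinv y (phi z))) = z.
  by move=> Vz; rewrite cinvK ?psiK//; exact/Wy/phiW.
have mc : {within D, continuous (psi \o cmap y)}.
  rewrite (continuous_open_subspace _ oD) => q; rewrite inE => -[yq Wq].
  by apply: continuous_comp; [exact: cmap_continuous|exact: psic].
have ic : {within V, continuous (cinv y \o phi)}.
  rewrite (continuous_open_subspace _ oV) => z; rewrite inE => Vz.
  by apply: continuous_comp; [exact: phic|exact/cinv_continuous/Wy/phiW].
exists (@Chart R M D V (psi \o cmap y) (cinv y \o phi) oD oV mD iV mK iK mc ic).
split=> // y' Ay'; have [s1 s2] := surface_smooth hM Ay Ay'.
have oT := @transition_domain_open y y'; have oT' := @transition_domain_open y' y.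
have cyy' : cdom y' `&` cdom y = cdom y `&` cdom y' by exact: setIC.
rewrite cyy' in oT'.
split; apply/smooth_onP => k.
- pose V' := V `&` phi @^-1` (cmap y @` (cdom y `&` cdom y')).
  have oV' : open V'.
    rewrite openE => z [Vz Tz]; apply: filterI; first exact: open_nbhs_nbhs.
    by apply: (phic _ Vz); exact: open_nbhs_nbhs.
  apply: (@Cn_subset _ _ _ k V').
    move=> _ [q [/= [yq Wq] y'q] <-]; split=> /=; first exact: psiV.
    by rewrite phiK//; exists q.
  have VV' : V' `<=` V by move=> z [].
  apply: (@Cn_comp_rV R _ 2 2 k V' _ phi (transition y y') oV' oT).
  - by move=> z [].
  - exact/(Cn_subset VV')/((smooth_onP _ _).1 phis).
  - exact: ((smooth_onP _ _).1 s1).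
- set T' := cmap y' @` (cdom y `&` cdom y') in oT' s2.
  have tT' z : T' z -> cimg y' z /\ cdom y (cinv y' z).
    by move=> [q [yq y'q] <-]; split; [exact: cmap_img|rewrite cmapK].
  pose V' := T' `&` transition y' y @^-1` W.
  have oV' : open V'.
    rewrite openE => z [Tz Wz]; apply: filterI; first exact: open_nbhs_nbhs.
    have tc : {for z, continuous (transition y' y)}.
      by apply: differentiable_continuous; exact: (s2 [::]).
    by apply: tc; exact: open_nbhs_nbhs.
  apply: (@Cn_subset _ _ _ k V').
    move=> _ [q [/= [yq Wq] y'q] <-]; split=> /=; first by exists q.
    by rewrite /transition /= cmapK.
  have VT' : V' `<=` T' by move=> z [].
  apply: (@Cn_comp_rV R _ 2 2 k V' _ (transition y' y) psi oV' oW).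
  - by move=> z [].
  - exact/(Cn_subset VT')/((smooth_onP _ _).1 s2).
  - exact: ((smooth_onP _ _).1 psis).
Qed.

End change_of_coordinates.

(** * Closed formulas in the coordinate u *)

Section explicit_formulas.
Variables (R : realType) (c : R) (s : bool).
Hypothesis c0 : 0 < c.
Let sg : R := (-1) ^+ s.

Let sgsg : sg * sg = 1.
Proof. by rewrite -expr2 sqrr_sign. Qed.

Let Eu u : R := expR (sg * (c * u)).

Let expR_2cu u : expR (sg * (2 * c * u)) = Eu u ^+ 2.
Proof. by rewrite /Eu expr2 -expRD; congr expR; ring. Qed.

Let is_derive_Eu (u : R) : is_derive u 1 Eu (sg * c * Eu u).
Proof.
have lin : is_derive u 1 (fun v => sg * (c * v)) (sg * c).
  have := is_derive_mul (is_derive_const sg u (1 : R))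
    (is_derive_mul (is_derive_const c u (1 : R)) (is_derive_id u (1 : R))).
  by move/is_derive_eq; apply; ring.
by have := is_derive1_comp (is_derive_expR _) lin; move/is_derive_eq; apply; rewrite mulrC.
Qed.

Let is_derive_Eu2 (u : R) : is_derive u 1 (fun v => Eu v * Eu v) (2 * sg * c * Eu u ^+ 2).
Proof.
have := is_derive_mul (is_derive_Eu u) (is_derive_Eu u).
by move/is_derive_eq; apply; ring.
Qed.

(** If D is the denominator in [theta_fun] and E = [Eu u], this is D^2 + (2 c E)^2, which appears on
    differentiating the arctangent of 2 c E / D. *)
Let W u := (1 - c ^+ 2 + Eu u ^+ 2) ^+ 2 + 4 * c ^+ 2 * Eu u ^+ 2.

Let W_gt0 u : 0 < W u.
Proof.
rewrite /W ltr_wpDl ?sqr_ge0// mulr_gt0 ?exprn_gt0 ?expR_gt0//.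
by rewrite mulr_gt0// exprn_gt0.
Qed.

Lemma is_derive_theta_fun u : theta_den c s u != 0 ->
  is_derive u 1 (theta_fun c s)
    (2 * sg * c ^+ 2 * Eu u * (1 - c ^+ 2 - Eu u ^+ 2) / W u).
Proof.
rewrite /theta_den expR_2cu => D0.
pose D v := 1 - c ^+ 2 + Eu v * Eu v.
have dD : is_derive u 1 D (2 * sg * c * Eu u ^+ 2).
  have := is_derive_add (is_derive_const (1 - c ^+ 2) u (1 : R)) (is_derive_Eu2 u).
  by move/is_derive_eq; apply; rewrite add0r.
have D0' : D u != 0 by rewrite /D -expr2.
have := is_derive1_comp (is_derive1_atan _) (is_derive_mul
  (is_derive_mul (is_derive_const (2 * c) u (1 : R)) (is_derive_Eu u))
  (is_deriveV D0' dD)).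
rewrite (_ : atan \o _ = theta_fun c s); last first.
  by apply/funext => v; rewrite /theta_fun /theta_den expR_2cu /= /D -expr2.
have W0 := lt0r_neq0 (W_gt0 u).
have W0' : D u ^+ 2 + (2 * c * Eu u) ^+ 2 != 0.
  by rewrite (_ : _ + _ = W u)// /W /D; ring.
move/is_derive_eq; apply; rewrite -[_ *: _]/(_ * _).
rewrite (_ : W u = D u ^+ 2 + (2 * c * Eu u) ^+ 2); last by rewrite /W /D; ring.
rewrite (_ : 1 - c ^+ 2 - Eu u ^+ 2 = D u - 2 * Eu u ^+ 2); last by rewrite /D; ring.
by field; rewrite W0' D0'.
Qed.

(* With E = exp(sg c u), the denominator D^2 + 4 c^2 E^2 of sin^2 theta factors
   as (E^2 + (1 - c)^2) (E^2 + (1 + c)^2). *)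
Lemma is_derive_primitive (k u : R) : theta_den c s u != 0 ->
  is_derive u 1 (fun v => sg / 2 * (ln (Eu v * Eu v + (1 - c) ^+ 2)
    - ln (Eu v * Eu v + (1 + c) ^+ 2)) + k) (sin (theta_fun c s u) ^+ 2).
Proof.
rewrite sin2cos2 /theta_fun /theta_den expR_2cu -/(Eu u) => D0.
have E0 : 0 < Eu u * Eu u by rewrite mulr_gt0 ?expR_gt0.
have dln a : is_derive u 1 (fun v => ln (Eu v * Eu v + a ^+ 2))
    ((Eu u * Eu u + a ^+ 2)^-1 * (2 * sg * c * Eu u ^+ 2)).
  have := is_derive1_comp (is_derive1_ln _)
    (is_derive_add (is_derive_Eu2 u) (is_derive_const (a ^+ 2) u (1 : R))).
  rewrite addr0; apply; by rewrite ltr_wpDr ?sqr_ge0.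
have := is_derive_add (is_derive_mul (is_derive_const (sg / 2) u (1 : R))
  (is_derive_add (dln (1 - c)) (is_derive_opp (dln (1 + c)))))
  (is_derive_const k u (1 : R)).
move/is_derive_eq; apply; rewrite cos_atan exprVn sqr_sqrtr; last first.
  by rewrite addr_ge0 ?sqr_ge0.
have W0 := lt0r_neq0 (W_gt0 u); move: W0 D0; rewrite /W.
have a0 : Eu u * Eu u + (1 - c) ^+ 2 != 0 by rewrite gt_eqF// ltr_wpDr ?sqr_ge0.
have b0 : Eu u * Eu u + (1 + c) ^+ 2 != 0 by rewrite gt_eqF// ltr_wpDr ?sqr_ge0.
move: (Eu u) E0 a0 b0 => e e0 a0 b0 W0 D0.
have W1 : (1 - c ^+ 2 + e ^+ 2) ^+ 2 + (2 * c * e) ^+ 2 != 0.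
  by rewrite (_ : (2 * c * e) ^+ 2 = 4 * c ^+ 2 * e ^+ 2)//; ring.
have -> : 1 - (1 + (2 * c * e / (1 - c ^+ 2 + e ^+ 2)) ^+ 2)^-1 =
    4 * c ^+ 2 * e ^+ 2 / ((e * e + (1 - c) ^+ 2) * (e * e + (1 + c) ^+ 2)).
  by field; rewrite a0 b0 D0 W1.
transitivity (sg * sg * (4 * c ^+ 2 * e ^+ 2 /
  ((e * e + (1 - c) ^+ 2) * (e * e + (1 + c) ^+ 2)))); last by rewrite sgsg mul1r.
by field; rewrite a0 b0.
Qed.

(** * Evaluation at a point with cosine C and signed curvature m *)

Section values.
Variables (C m : R).
Hypotheses (C0 : 0 < C) (C1 : C < 1) (cCm : 0 < c * C + m)
  (rel : m ^+ 2 + 1 - C ^+ 2 = c ^+ 2).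
Let S := Num.sqrt (1 - C ^+ 2).
Let u := sg / c * (ln (c * C + m) - ln (1 - C ^+ 2) / 2).

Let C2 : 0 < 1 - C ^+ 2.
Proof. by rewrite subr_gt0 expr_lt1// ltW. Qed.

Let S0 : 0 < S.
Proof. by rewrite sqrtr_gt0. Qed.

Let S2 : S * S = 1 - C ^+ 2.
Proof. by rewrite -expr2 sqr_sqrtr// ltW. Qed.

Let EuE : Eu u = (c * C + m) / S.
Proof.
rewrite /Eu /u; have -> : sg * (c * (sg / c * (ln (c * C + m) - ln (1 - C ^+ 2) / 2))) =
    ln (c * C + m) - ln S.
  rewrite -S2 lnM ?posrE//; set a := ln _; set b := ln _.
  transitivity (sg * sg * (a - b)); last by rewrite sgsg mul1r.
  by field; rewrite gt_eqF.
by rewrite expRD expRN !lnK// posrE.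
Qed.

Let rel' : m ^+ 2 = c ^+ 2 - S * S.
Proof. by rewrite S2 -rel; ring. Qed.

(** This is the quadratic equation E^2 + 1 - c^2 = 2 c E cot theta. It makes the denominator
    positive and turns the argument of the arctangent into S / C = tan theta. *)
Let denE : theta_den c s u = 2 * c * Eu u * C / S.
Proof.
rewrite /theta_den expR_2cu EuE.
have Sn : S != 0 by rewrite gt_eqF.
apply: (mulIf Sn); apply: (mulIf Sn); rewrite divfK//.
transitivity ((1 - c ^+ 2) * (S * S) + (c * C + m) ^+ 2); first by field.
transitivity (2 * c * (c * C + m) * C); last by field.
have -> : (c * C + m) ^+ 2 = c ^+ 2 * C ^+ 2 + 2 * c * C * m + m ^+ 2 by ring.
rewrite rel' S2; ring.
Qed.

Lemma theta_den_neq0 : theta_den c s u != 0.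
Proof.
by rewrite denE gt_eqF// divr_gt0// mulr_gt0// mulr_gt0 ?expR_gt0// mulr_gt0.
Qed.

Lemma theta_funE : theta_fun c s u = acos C.
Proof.
have E0 : Eu u != 0 by rewrite gt_eqF ?expR_gt0.
rewrite /theta_fun -/(Eu u) denE.
have -> : 2 * c * Eu u / (2 * c * Eu u * C / S) = S / C.
  by field; rewrite E0 !gt_eqF.
have C11 : -1 <= C <= 1 by rewrite (ltW C1) andbT (le_trans _ (ltW C0))// lerN10.
have t0 : 0 <= S / C by rewrite divr_ge0// ltW.
rewrite -[LHS]cosK.
  congr acos; rewrite cos_atan; have -> : 1 + (S / C) ^+ 2 = (C^-1) ^+ 2.
    have -> : (S / C) ^+ 2 = S * S / C ^+ 2 by field; rewrite gt_eqF.
    by rewrite S2; field; rewrite gt_eqF.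
  by rewrite sqrtr_sqr ger0_norm ?invrK// invr_ge0 ltW.
rewrite in_itv /= -atan0 le_atan//= (le_trans (ltW (atan_ltpi2 _)))//.
by rewrite ler_pdivrMr// ler_peMr ?pi_ge0// ler1n.
Qed.

Lemma sin_theta_fun : sin (theta_fun c s u) = S.
Proof.
by rewrite theta_funE sin_acos// (ltW C1) andbT (le_trans _ (ltW C0))// lerN10.
Qed.

(** For m = - sg lambda the right-hand side is lambda sin theta, the stated relation between lambda
    and theta'. *)
Lemma derive1_theta_fun : derive1 (theta_fun c s) u = - sg * m * S.
Proof.
rewrite derive1E; have [_ ->] := is_derive_theta_fun theta_den_neq0.
have E0 : Eu u != 0 by rewrite gt_eqF ?expR_gt0.
have Sn : S != 0 by rewrite gt_eqF.
have DE : 1 - c ^+ 2 + Eu u ^+ 2 = 2 * c * Eu u * C / S.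
  by rewrite -denE /theta_den expR_2cu.
have -> : W u = 4 * c ^+ 2 * Eu u ^+ 2 / (S * S).
  have -> : W u = 4 * c ^+ 2 * Eu u ^+ 2 * (C ^+ 2 + S * S) / (S * S).
    by rewrite /W DE; field.
  by rewrite S2 addrC subrK mulr1.
have -> : 1 - c ^+ 2 - Eu u ^+ 2 = - 2 * Eu u * m / S.
  transitivity (2 * c * Eu u * C / S - 2 * Eu u * Eu u); first by rewrite -DE; ring.
  by rewrite {2}EuE; field.
by field; rewrite E0 Sn gt_eqF.
Qed.

(** Rewrites the primitive of sin^2 theta in terms of ln (C + m), the same logarithm that the
    exponential invariant relates to the height. *)
Lemma primitiveE (k : R) : 0 < C + m ->
  sg / 2 * (ln (Eu u * Eu u + (1 - c) ^+ 2) - ln (Eu u * Eu u + (1 + c) ^+ 2)) + k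
  = sg * (ln (C + m) - ln (1 + c)) + k.
Proof.
move=> Cm; congr (_ + _).
have E0 : 0 < Eu u * Eu u by rewrite mulr_gt0 ?expR_gt0.
have a0 : 0 < Eu u * Eu u + (1 - c) ^+ 2 by rewrite ltr_wpDr ?sqr_ge0.
have b0 : 0 < Eu u * Eu u + (1 + c) ^+ 2 by rewrite ltr_wpDr ?sqr_ge0.
have c1 : 0 < 1 + c by rewrite addr_gt0.
have H : (Eu u * Eu u + (1 - c) ^+ 2) * ((1 + c) * (1 + c)) =
    (C + m) * (C + m) * (Eu u * Eu u + (1 + c) ^+ 2).
  have Sn : S * S != 0 by rewrite mulf_neq0// gt_eqF.
  have Ek k' : (Eu u * Eu u + k') * (S * S) = (c * C + m) ^+ 2 + k' * (1 - C ^+ 2).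
    by rewrite EuE -S2; field; rewrite gt_eqF.
  apply: (mulIf Sn); rewrite mulrAC Ek -[RHS]mulrA Ek.
  (* The two sides agree only modulo [rel]; the second summand is the required explicit multiple of
     that relation. *)
  transitivity ((C + m) * (C + m) * ((c * C + m) ^+ 2 + (1 + c) ^+ 2 * (1 - C ^+ 2))
    + (m ^+ 2 + 1 - C ^+ 2 - c ^+ 2) * (- m ^+ 2 - 2 * (1 + c) * C * m
      - 2 * c * C ^+ 2 - (c ^+ 2 - 1 + C ^+ 2))); first by ring.
  by rewrite rel subrr mul0r addr0.
have := congr1 (@ln R) H; rewrite !lnM ?posrE ?mulr_gt0//.
move=> E; transitivity (sg / 2 * (2 * (ln (C + m) - ln (1 + c)))); last by field.
by congr (_ * _); lra.
Qed.

End values.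

End explicit_formulas.

(** In the half plane 0 < a the arctangent of b / a is a polar angle, so no choice of branch
    arises. *)
Lemma polar_coordinates (R : realType) (rho a b : R) : 0 < rho -> 0 < a ->
  a ^+ 2 + b ^+ 2 = rho ^+ 2 ->
  rho * cos (atan (b / a)) = a /\ rho * sin (atan (b / a)) = b.
Proof.
move=> rho0 a0 ab.
have an0 : a != 0 by rewrite gt_eqF.
have cosE : cos (atan (b / a)) = a / rho.
  rewrite cos_atan; have -> : 1 + (b / a) ^+ 2 = (rho / a) ^+ 2.
    by rewrite [RHS]exprMn -ab; field.
  by rewrite sqrtr_sqr ger0_norm ?invf_div// divr_ge0// ltW.
have sinE : sin (atan (b / a)) = b / a * cos (atan (b / a)).
  by rewrite -[X in _ = X * _](atanK (b / a)) /tan divfK// cosE mulf_neq0// invr_neq0// gt_eqF.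
by rewrite sinE cosE; split; field; rewrite ?an0 ?(gt_eqF rho0).
Qed.

(** * An orthonormal frame adapted to the axis *)

Section local_description.
Variables (R : realType) (M : topologicalType) (A : set (chart R M))
    (F xi : M -> 'rV[R]_4) (lambda : M -> R).
Hypotheses (hM : oriented_surface A) (hF : immersion A F)
    (hxi : unit_normal A F xi) (humb : totally_umbilical A F xi lambda)
    (hgeo : ~ totally_geodesic A F xi).
Variables (p : M) (a : 'rV[R]_4) (c : R).
Hypotheses (Cp : 0 < xi p 0 3 < 1) (c0 : 0 < c)
  (aE : forall q (i : 'I_4), (i < 3)%N -> lambda q * F q 0 i + xi q 0 i = a 0 i)
  (cE : forall q, lambda q ^+ 2 + 1 - xi q 0 3 ^+ 2 = c ^+ 2).

(* The rows of the frame are a / c = (l x + n) / c, then (s x - (l / s) n) / c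
   with s = |n|, and their cross product. *)
Lemma adapted_frame : exists Q : 'M[R]_4, [/\ Q *m Q^T = 1%:M,
  forall y : 'rV[R]_4, (y *m Q) 0 3 = y 0 3,
  forall q, (F q *m Q) 0 0 = c^-1 * lambda q & 0 < (F p *m Q) 0 1].
Proof.
have /andP[C0 C1] := Cp.
have S2 : 0 < 1 - xi p 0 3 ^+ 2 by rewrite subr_gt0 expr_lt1// ltW.
pose S := Num.sqrt (1 - xi p 0 3 ^+ 2).
have S0 : 0 < S by rewrite sqrtr_gt0.
have SS : S * S = 1 - xi p 0 3 ^+ 2 by rewrite -expr2 sqr_sqrtr// ltW.
have Sn : S != 0 by rewrite gt_eqF.
have cn : c != 0 by rewrite gt_eqF.
pose r0 := c^-1 *: (lambda p *: F p + xi p).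
pose r1 := c^-1 *: (S *: F p - (lambda p / S) *: xi p).
have cc : lambda p * lambda p + S * S = c * c.
  by rewrite SS -!expr2 -(cE p); ring.
have [nx nn] := normal_components hxi p; have xx := immersion_range hF p.
rewrite /S2xR /= in xx.
have {}nn : xi p 0 0 * xi p 0 0 + xi p 0 1 * xi p 0 1 + xi p 0 2 * xi p 0 2 = S * S.
  by rewrite SS -nn; ring.
have r0E i : r0 0 i = c^-1 * (lambda p * F p 0 i + xi p 0 i) by rewrite !mxE.
have r1E i : r1 0 i = c^-1 * (S * F p 0 i - lambda p / S * xi p 0 i) by rewrite !mxE.
have FF : frame r0 r1 *m (frame r0 r1)^T = 1%:M.
  apply: frame_orthogonal; rewrite dotE !nuE ?r0E ?r1E.
  - transitivity (c^-1 * c^-1 * (lambda p * lambda p *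
      (F p 0 0 ^+ 2 + F p 0 1 ^+ 2 + F p 0 2 ^+ 2) + 2 * lambda p *
      (xi p 0 0 * F p 0 0 + xi p 0 1 * F p 0 1 + xi p 0 2 * F p 0 2)
      + (xi p 0 0 * xi p 0 0 + xi p 0 1 * xi p 0 1 + xi p 0 2 * xi p 0 2))).
      by ring.
    by rewrite xx nx nn mulr1 mulr0 addr0 cc; field.
  - transitivity (c^-1 * c^-1 * (S * S *
      (F p 0 0 ^+ 2 + F p 0 1 ^+ 2 + F p 0 2 ^+ 2) - 2 * lambda p *
      (xi p 0 0 * F p 0 0 + xi p 0 1 * F p 0 1 + xi p 0 2 * F p 0 2)
      + lambda p * lambda p / (S * S) *
       (xi p 0 0 * xi p 0 0 + xi p 0 1 * xi p 0 1 + xi p 0 2 * xi p 0 2))).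
      by field; rewrite cn Sn.
    by rewrite xx nx nn mulr1 mulr0 subr0 divfK ?mulf_neq0// addrC cc; field.
  - transitivity (c^-1 * c^-1 * (S * lambda p *
      (F p 0 0 ^+ 2 + F p 0 1 ^+ 2 + F p 0 2 ^+ 2) + (S - lambda p * lambda p / S) *
      (xi p 0 0 * F p 0 0 + xi p 0 1 * F p 0 1 + xi p 0 2 * F p 0 2)
      - lambda p / S *
       (xi p 0 0 * xi p 0 0 + xi p 0 1 * xi p 0 1 + xi p 0 2 * xi p 0 2))).
      by field; rewrite cn Sn.
    by rewrite xx nx nn; field; rewrite cn Sn.
exists (frame r0 r1)^T; split.
- by rewrite trmxK; exact: mulmx1C.
- by move=> y; rewrite frameE vec4E.
- move=> q; rewrite frameE vec4E dotE !nuE mulr0 addr0.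
  have r0a (i : 'I_4) : (i < 3)%N -> r0 0 i = c^-1 * (lambda q * F q 0 i + xi q 0 i).
    by move=> i3; rewrite r0E !aE.
  rewrite !r0a//; have [nxq _] := normal_components hxi q.
  have := immersion_range hF q; rewrite /S2xR /= => xxq.
  transitivity (c^-1 * (lambda q * (F q 0 0 ^+ 2 + F q 0 1 ^+ 2 + F q 0 2 ^+ 2)
    + (xi q 0 0 * F q 0 0 + xi q 0 1 * F q 0 1 + xi q 0 2 * F q 0 2))); first by ring.
  by rewrite xxq nxq mulr1 addr0.
(* The value is S / c. Its positivity puts [p] in the half plane where the arctangent gives the
   polar angle. *)
- rewrite frameE vec4E dotE !nuE mulr0 addr0 !r1E.
  have -> : F p 0 0 * (c^-1 * (S * F p 0 0 - lambda p / S * xi p 0 0)) +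
    F p 0 1 * (c^-1 * (S * F p 0 1 - lambda p / S * xi p 0 1)) +
    F p 0 2 * (c^-1 * (S * F p 0 2 - lambda p / S * xi p 0 2)) =
    c^-1 * (S * (F p 0 0 ^+ 2 + F p 0 1 ^+ 2 + F p 0 2 ^+ 2) - lambda p / S *
    (xi p 0 0 * F p 0 0 + xi p 0 1 * F p 0 1 + xi p 0 2 * F p 0 2)) by ring.
  by rewrite xx nx mulr1 mulr0 subr0 mulr_gt0// invr_gt0.
Qed.

End local_description.

(** * The coordinates u and v near a given point *)

Section adapted_coordinates.
Variables (R : realType) (M : topologicalType) (A : set (chart R M))
    (F xi : M -> 'rV[R]_4) (lambda : M -> R).
Hypotheses (hM : oriented_surface A) (hF : immersion A F)
    (hxi : unit_normal A F xi) (humb : totally_umbilical A F xi lambda)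
    (hgeo : ~ totally_geodesic A F xi).
Variables (p : M) (c : R) (s : bool) (Q : 'M[R]_4).
Hypotheses (Cp : 0 < xi p 0 3 < 1) (c0 : 0 < c)
  (cE : forall q, lambda q ^+ 2 + 1 - xi q 0 3 ^+ 2 = c ^+ 2)
  (QQ : Q *m Q^T = 1%:M) (Q3 : forall y : 'rV[R]_4, (y *m Q) 0 3 = y 0 3)
  (Q0 : forall q, (F q *m Q) 0 0 = c^-1 * lambda q) (Qp : 0 < (F p *m Q) 0 1)
  (sp : 0 <= - (-1) ^+ s * lambda p).

Let sg : R := (-1) ^+ s.
Local Notation C q := (xi q 0 3).
Local Notation m q := (- sg * lambda q).

Let sgsg : sg * sg = 1.
Proof. by rewrite -expr2 sqrr_sign. Qed.

(* exp(sg c u) = (c C + m) / sin theta is a root E of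
   E^2 - 2 c cot(theta) E + 1 - c^2 = 0, which is the formula for theta. *)
Definition u_coordinate q : R :=
  sg / c * (ln (c * C q + m q) - ln (1 - C q ^+ 2) / 2).

Definition v_coordinate q : R := atan ((F q *m Q) 0 2 / (F q *m Q) 0 1).

(** These inequalities make both logarithms in [u_coordinate] and the polar angle [v_coordinate]
    meaningful, and put theta strictly between 0 and pi / 2. They hold at [p] by the choice of [s]
    and [Q], and persist nearby. *)
Definition adapted q := [/\ 0 < C q, C q < 1, 0 < c * C q + m q &
  0 < (F q *m Q) 0 1].

Lemma curvature_sign q : m q ^+ 2 + 1 - C q ^+ 2 = c ^+ 2.
Proof.
rewrite -(cE q); congr (_ + _ - _).
by rewrite exprMn sqrrN expr2 sgsg mul1r.
Qed.

(** An orthogonal [Q] fixing the height preserves the unit sphere, and the coordinate along the axis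
    is lambda / c, so the radius around the axis is sin theta / c. *)
Lemma frame_radius q : (F q *m Q) 0 1 ^+ 2 + (F q *m Q) 0 2 ^+ 2 =
  (1 - C q ^+ 2) / c ^+ 2.
Proof.
have /S2xR_dot := immersion_range hF q; rewrite -(dot_orthogonal _ _ QQ) -Q3.
rewrite dotE Q0 => H; have cn : c != 0 by rewrite gt_eqF.
have -> : (1 - C q ^+ 2) / c ^+ 2 = 1 - (c^-1 * lambda q) ^+ 2.
  have -> : 1 - C q ^+ 2 = c ^+ 2 - lambda q ^+ 2 by rewrite -(cE q); ring.
  by field.
by rewrite -H; ring.
Qed.

(** This is the exponential invariant for the sign - sg, multiplied by - sg. Its positivity at [p]
    spreads to M, so ln (C + m) is meaningful everywhere. *)
Lemma exp_height_constant : exists2 B : R, 0 < B &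
  forall q, expR (- sg * F q 0 3) * (C q + m q) = B.
Proof.
have /andP[C0 C1] := Cp.
exists (expR (- sg * F p 0 3) * (C p + m p)).
  by rewrite mulr_gt0 ?expR_gt0// ltr_wpDr.
move=> q; have ss : - sg * - sg = 1 by rewrite mulrNN.
have := umbilical_exp hM hF hxi humb q p ss.
move/(congr1 ( *%R (- sg))); rewrite !(mulrCA (- sg)) !(mulrDr (- sg)).
rewrite !(mulrA (- sg) (- sg)) ss !mul1r => H.
by rewrite ![C _ + _]addrC.
Qed.

Lemma primitive_height : exists G : R -> R, forall q, adapted q ->
  is_derive (u_coordinate q) 1 G (sin (theta_fun c s (u_coordinate q)) ^+ 2) /\
  G (u_coordinate q) = F q 0 3.
Proof.
have [B B0 BE] := exp_height_constant.
(* The constant replaces the term ln (1 + c) of [primitiveE] by ln B, since the invariant gives h =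
   sg (ln (C + m) - ln B). *)
pose k := sg * (ln (1 + c) - ln B).
exists (fun v => sg / 2 * (ln (expR (sg * (c * v)) * expR (sg * (c * v))
  + (1 - c) ^+ 2) - ln (expR (sg * (c * v)) * expR (sg * (c * v)) + (1 + c) ^+ 2)) + k).
move=> q [C0 C1 cCm w0]; have rel := curvature_sign q.
split; first exact: (is_derive_primitive c0 k (theta_den_neq0 s c0 C0 C1 cCm rel)).
have Cm : 0 < C q + m q.
  by have := B0; rewrite -(BE q) pmulr_rgt0// expR_gt0.
rewrite (primitiveE s c0 C0 C1 cCm rel)//.
have := congr1 (@ln R) (BE q); rewrite lnM ?posrE ?expR_gt0// expRK => E.
rewrite /k -E -/sg; move: sg sgsg => r rr.
transitivity (r * r * F q 0 3); first by ring.
by rewrite rr mul1r.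
Qed.

Section in_chart.
Variable y : chart R M.
Hypothesis Ay : A y.
Let f := F \o cinv y.
Let N := xi \o cinv y.

Lemma Cn_C k : Cn k (cimg y) (fun z => C (cinv y z)).
Proof.
have oU := @cimg_open _ _ y.
have := (smooth_onP _ _).1 (normal_smooth hxi Ay) k.
by move/(Cn_rVP _ _ oU) => /(_ 3).
Qed.

Lemma Cn_frame k i : Cn k (cimg y) (fun z => (F (cinv y z) *m Q) 0 i).
Proof.
have oU := @cimg_open _ _ y.
have := Cn_mulmx Q oU ((smooth_onP _ _).1 (immersion_smooth hF Ay) k).
by move/(Cn_rVP _ _ oU) => /(_ i).
Qed.

(** Higher regularity of lambda comes for free from [Q0]: lambda is c times a coordinate of the
    smooth map F Q. *)
Lemma Cn_m k : Cn k (cimg y) (fun z => m (cinv y z)).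
Proof.
have oU := @cimg_open _ _ y.
have H := CnM oU (@Cn_cst _ _ _ k _ (- sg * c)) (@Cn_frame k 0).
apply: (@Cn_ext _ _ _ _ _ _ _ oU _ H) => z _.
by rewrite /= Q0 mulrA mulfK// gt_eqF.
Qed.

Lemma Cn_cCm k : Cn k (cimg y) (fun z => c * C (cinv y z) + m (cinv y z)).
Proof.
have oU := @cimg_open _ _ y.
exact: (CnD oU (CnM oU (@Cn_cst _ _ _ k _ c) (@Cn_C k)) (@Cn_m k)).
Qed.

(** The interior is open by construction; that it contains the image of [p] is the content of
    [adapted_near]. *)
Let U := interior [set z | cimg y z /\ adapted (cinv y z)].

Let oU : open U.
Proof. exact: open_interior. Qed.

Let U_adapted z : U z -> cimg y z /\ adapted (cinv y z).
Proof. by move/interior_subset. Qed.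

Let Uy : U `<=` cimg y.
Proof. by move=> z /U_adapted[]. Qed.

Lemma Cn_u k : Cn k U (fun z => u_coordinate (cinv y z)).
Proof.
have H1 : Cn k U (fun z => ln (c * C (cinv y z) + m (cinv y z))).
  apply: Cn_ln => //; last exact: (Cn_subset Uy (@Cn_cCm k)).
  by move=> z /U_adapted[_ []].
have H2 : Cn k U (fun z => ln (1 - C (cinv y z) ^+ 2)).
  apply: Cn_ln => //.
    by move=> z /U_adapted[_ [C0 C1 _ _]]; rewrite subr_gt0 expr_lt1// ltW.
  have CU := Cn_subset Uy (@Cn_C k).
  apply: Cn_ext (CnD oU (@Cn_cst _ _ _ k U (1 : R)) (CnN oU (CnM oU CU CU))) => //.
have H3 := CnM oU H2 (@Cn_cst _ _ _ k U (2^-1 : R)).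
exact: (CnM oU (@Cn_cst _ _ _ k U (sg / c)) (CnD oU H1 (CnN oU H3))).
Qed.

Lemma Cn_tan_v k :
  Cn k U (fun z => (F (cinv y z) *m Q) 0 2 / (F (cinv y z) *m Q) 0 1).
Proof.
apply: (CnM oU (Cn_subset Uy (@Cn_frame k 2))).
apply: CnV => //; last exact: (Cn_subset Uy (@Cn_frame k 1)).
by move=> z /U_adapted[_ [_ _ _ w1]]; rewrite gt_eqF.
Qed.

Lemma adapted_near : cdom y p -> U (cmap y p).
Proof.
move=> yp; have zp : cimg y (cmap y p) by exact: cmap_img.
have /andP[C0 C1] := Cp.
have cont (g : M -> R) : Cn 0 (cimg y) (fun z => g (cinv y z)) -> 0 < g p ->
    \forall z \near cmap y p, 0 < g (cinv y z).
  move=> gy gp; have := differentiable_continuous (Cn_differentiable gy zp).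
  by move=> /cvgr_gt; apply; rewrite /= cmapK.
have H0 : \forall z \near cmap y p, cimg y z.
  by apply: open_nbhs_nbhs; split=> //; exact: cimg_open.
have H1 := cont (fun q => C q) (@Cn_C 0) C0.
have H2 := cont (fun q => 1 + - C q) (CnD (@cimg_open _ _ y)
  (@Cn_cst _ _ _ 0 _ (1 : R)) (CnN (@cimg_open _ _ y) (@Cn_C 0))).
rewrite subr_gt0 in H2; have {}H2 := H2 C1.
have H3 : \forall z \near cmap y p, 0 < c * C (cinv y z) + m (cinv y z).
  by apply: (cont (fun q => c * C q + m q) (@Cn_cCm 0)); rewrite ltr_wpDr// mulr_gt0.
have H4 : \forall z \near cmap y p, 0 < (F (cinv y z) *m Q) 0 1.
  exact: (cont (fun q => (F q *m Q) 0 1) (@Cn_frame 0 1)).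
apply: filterS2 (filterI H0 H1) (filterI H2 (filterI H3 H4)).
by move=> z [z0 z1] [z2 [z3 z4]]; split=> //; split=> //; rewrite -subr_gt0.
Qed.

Definition coordinate_map z : 'rV[R]_2 :=
  \row_i [:: u_coordinate (cinv y z); v_coordinate (cinv y z)]`_i.

Lemma coordinate_mapE z : (coordinate_map z 0 0 = u_coordinate (cinv y z)) *
  (coordinate_map z 0 1 = v_coordinate (cinv y z)).
Proof. by rewrite !mxE. Qed.

Lemma smooth_coordinate_map : smooth_on U coordinate_map.
Proof.
apply/smooth_onP => k; apply/Cn_rVP => // -[[|[|//]] i2].
- apply: (@Cn_ext _ _ _ _ _ _ _ oU _ (@Cn_u k)) => z _.
  by rewrite mxE.
- apply: (@Cn_ext _ _ _ _ _ _ _ oU _ (Cn_atan oU (@Cn_tan_v k))) => z _.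
  by rewrite [RHS]mxE.
Qed.

(** If du = 0, then dh = 0 because h is a function of u, and hence dC = 0 and d lambda = 0. So the
    axial coordinate, the radius and the height of F Q are stationary; dv = 0 makes the ratio of the
    two remaining coordinates stationary too. Hence dF = 0 in this direction. *)
Lemma coordinate_map_immersion z w : U z -> 'D_w coordinate_map z = 0 -> w = 0.
Proof.
move=> Uz Dw; have [yz ad] := U_adapted Uz.
have hP := chart_patch hF hxi humb Ay.
have fd : differentiable f z by exact: (patch_smooth hP [::]).
have Nd : differentiable N z by exact: (patch_normal_smooth hP [::]).
have cd : differentiable coordinate_map z by exact: (smooth_coordinate_map [::]).
have Du : 'D_w (fun z => u_coordinate (cinv y z)) z = 0.
  have -> : (fun z => u_coordinate (cinv y z)) = fun z => coordinate_map z 0 0.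
    by apply/funext => z'; rewrite coordinate_mapE.
  by rewrite -derive_rV// Dw mxE.
have Dv : 'D_w (fun z => v_coordinate (cinv y z)) z = 0.
  have -> : (fun z => v_coordinate (cinv y z)) = fun z => coordinate_map z 0 1.
    by apply/funext => z'; rewrite coordinate_mapE.
  by rewrite -derive_rV// Dw mxE.
have ud : differentiable (fun z => u_coordinate (cinv y z)) z.
  exact: Cn_differentiable (@Cn_u 0) Uz.
have [G GP] := primitive_height.
have D3 : ('D_w f z) 0 3 = 0.
  have [_ GE] := derive_comp1 w ud (GP _ ad).1; rewrite Du mul0r in GE.
  rewrite derive_rV// -GE; apply: near_eq_derive.
  near=> z'; have Uz' : U z' by near: z'; exact: open_nbhs_nbhs.
  by have [_] := GP _ (U_adapted Uz').2.
have DC : ('D_w N z) 0 3 = 0 by rewrite (derive_angle hP)// D3 mulr0.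
have dl : is_derive z w (lambda \o cinv y) 0.
  have <- : 'D_w (lambda \o cinv y) z = 0 by rewrite (derive_curvature hP)// D3 mulr0.
  by apply/derivableP/diff_derivable; exact: (differentiable_curvature hP).
have fQd : differentiable (fun z => f z *m Q) z.
  exact: Cn_differentiable (Cn_mulmx Q (@cimg_open _ _ y)
    ((smooth_onP _ _).1 (immersion_smooth hF Ay) 0)) yz.
have dQ i : is_derive z w (fun z => (f z *m Q) 0 i) (('D_w f z *m Q) 0 i).
  by have := is_derive_rV w i fQd; rewrite derive_mulmx.
have td : differentiable (fun z => (f z *m Q) 0 2 / (f z *m Q) 0 1) z.
  exact: Cn_differentiable (@Cn_tan_v 0) Uz.
have dt : is_derive z w (fun z => (f z *m Q) 0 2 / (f z *m Q) 0 1) 0.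
  have [_ aE] := derive_comp1 w td (is_derive1_atan _).
  have := aE; rewrite [X in X = _]Dv => /esym/eqP; rewrite mulf_eq0 invr_eq0.
  rewrite (gt_eqF (ltr_wpDr (sqr_ge0 _) ltr01)) orbF => /eqP <-.
  exact/derivableP/diff_derivable.
have w1 z' : U z' -> (f z' *m Q) 0 1 != 0.
  by move=> /U_adapted[_ [_ _ _ w0]]; rewrite gt_eqF.
set d := 'D_w f z *m Q in dQ *.
have d0 : d 0 0 = 0.
  have e0 z' : U z' -> (f z' *m Q) 0 0 = c^-1 * (lambda \o cinv y) z' by rewrite Q0.
  rewrite (is_derive_near_eq oU Uz e0 (dQ 0) (is_derive_mul (is_derive_const c^-1 z w) dl)).
  by rewrite !mulr0 addr0.
have d3 : d 0 3 = 0 by rewrite /d Q3.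
have d2 : d 0 2 = (f z *m Q) 0 2 / (f z *m Q) 0 1 * d 0 1.
  have e2 z' : U z' -> (f z' *m Q) 0 2 =
      (f z' *m Q) 0 2 / (f z' *m Q) 0 1 * (f z' *m Q) 0 1.
    by move=> Uz'; rewrite divfK// w1.
  rewrite (is_derive_near_eq oU Uz e2 (dQ 2) (is_derive_mul dt (dQ 1))).
  by rewrite mulr0 addr0.
have d1 : d 0 1 = 0.
  have dC : is_derive z w (fun z => N z 0 3) 0 by rewrite -DC; exact: is_derive_rV.
  have e1 z' : U z' -> (f z' *m Q) 0 1 * (f z' *m Q) 0 1 +
      (f z' *m Q) 0 2 * (f z' *m Q) 0 2 =
      (1 + - (N z' 0 3 * N z' 0 3)) * (c ^+ 2)^-1.
    by move=> _; rewrite -!expr2 frame_radius.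
  have := is_derive_near_eq oU Uz e1
    (is_derive_add (is_derive_mul (dQ 1) (dQ 1)) (is_derive_mul (dQ 2) (dQ 2)))
    (is_derive_mul (is_derive_add (is_derive_const (1 : R) z w)
       (is_derive_opp (is_derive_mul dC dC))) (is_derive_const (c ^+ 2)^-1 z w)).
  rewrite d2; have := w1 z Uz; move: ((f z *m Q) 0 1) ((f z *m Q) 0 2) (d 0 1).
  move=> a b e a0 H.
  (* The derivative of the squared radius factors with 1 + (b / a)^2 > 0, which leaves e = 0. *)
  have {}H : a * e * (1 + (b / a) ^+ 2) = 0.
    transitivity ((a * e + a * e + (b * (b / a * e) + b * (b / a * e))) / 2).
      by field.
    by rewrite H !(mulr0, addr0, oppr0, mul0r).
  move/eqP: H; rewrite mulf_eq0 (gt_eqF (ltr_wpDr (sqr_ge0 _) ltr01)) orbF.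
  by rewrite mulf_eq0 (negbTE a0) => /eqP.
apply: (patch_inj hP yz); rewrite -[LHS]mulmx1 -QQ mulmxA -/d.
suff -> : d = 0 by rewrite mul0mx.
apply/rowP; apply: forall_I4; rewrite [RHS]mxE //.
by rewrite d2 d1 mulr0.
Unshelve. all: by end_near. Qed.

End in_chart.
Lemma adapted_chart : exists x : chart R M, [/\ local_coordinates A x, cdom x p &
  forall q, cdom x q -> [/\ adapted q, cmap x q 0 0 = u_coordinate q &
    cmap x q 0 1 = v_coordinate q]].
Proof.
have [y Ay yp] := surface_cover hM p; have Up := adapted_near Ay yp.
have [W [V [phi [[oW Wp WU oV] [psiV phiW psiK phiK phis]]]]] :=
  inverse_function (@open_interior _ _) Up (smooth_coordinate_map Ay)
  (fun w => coordinate_map_immersion Ay Up).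
have Wy : W `<=` cimg y by move=> z /WU/interior_subset[].
have Ws : smooth_on W (coordinate_map y).
  move=> l z Wz; exact: (smooth_coordinate_map Ay l (WU _ Wz)).
have [x [xA xdom xmap]] := change_coordinates hM Ay oW Wy oV psiV phiW psiK phiK Ws phis.
exists x; split=> //; first by apply/xdom.
move=> q /xdom[yq Wq]; rewrite xmap !coordinate_mapE cmapK//; split=> //.
by have /interior_subset[_] := WU _ Wq; rewrite cmapK.
Qed.

End adapted_coordinates.

(** * Assembly of the classification *)

Unset Implicit Arguments.

Theorem theorem6 (R : realType) (M : topologicalType) (A : set (chart R M))
    (F xi : M -> 'rV[R]_4) (lambda : M -> R)
    (hM : oriented_surface A)
    (hF : immersion A F)
    (hxi : unit_normal A F xi)
    (humb : totally_umbilical A F xi lambda)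
    (hgeo : ~ totally_geodesic A F xi) :
  let theta := angle xi in
  dense [set p | [/\ 0 < theta p, theta p < pi & theta p != pi / 2]] /\
  forall p : M, theta p != 0 -> (\forall q \near p, theta q <= pi / 2) ->
    exists x : chart R M, [/\ local_coordinates A x, cdom x p &
      let u := fun q => cmap x q 0 0 in
      let v := fun q => cmap x q 0 1 in
      exists (c : R) (s : bool), 0 < c /\
        (forall q, cdom x q ->
          [/\ theta_den c s (u q) != 0,
              theta q = theta_fun c s (u q) &
              lambda q = derive1 (theta_fun c s) (u q) / sin (theta_fun c s (u q))]) /\
        exists (Phi : 'rV[R]_4 -> 'rV[R]_4) (G : R -> R), isometry_S2xR Phi /\
          forall q, cdom x q ->
            is_derive (u q) 1 G (sin (theta_fun c s (u q)) ^+ 2) /\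
            Phi (F q) = c^-1 *: vec4 (lambda q)
                                     (sin (theta q) * cos (v q))
                                     (sin (theta q) * sin (v q))
                                     (c * G (u q))].
Proof.
move=> theta; split; first exact: (dense_generic_angle hM hF hxi humb hgeo).
move=> p tp tnear.
have Cp := cos_angle_gt0 hM hF hxi humb hgeo tp tnear.
have [a [c [c0 aE cE]]] := curvature_relation hM hF hxi humb hgeo.
have [Q [QQ Q3 Q0 Qp]] := adapted_frame hF hxi Cp c0 aE cE.
(* The minus sign is taken exactly when lambda is positive at [p], so that m = - sg lambda equals
   |lambda| there. *)
pose s := 0 < lambda p.
have sp : 0 <= - (-1) ^+ s * lambda p.
  rewrite /s; have [lp|lp] := ltP 0 (lambda p).
    by rewrite expr1 opprK mul1r ltW.
  by rewrite expr0 mulN1r oppr_ge0.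
have [x [xA xp xE]] := adapted_chart hM hF hxi humb Cp c0 cE QQ Q3 Q0 Qp sp.
have [G GP] := primitive_height hM hF hxi humb Q Cp c0 cE sp.
exists x; split=> // u v; exists c, s; split=> //.
have sgsg : (-1) ^+ s * (-1) ^+ s = 1 :> R by rewrite -expr2 sqrr_sign.
have sinE q : cdom x q -> sin (theta q) = Num.sqrt (1 - xi q 0 3 ^+ 2).
  by move=> _; exact: (sin_angle hxi).
split.
  move=> q xq; have [[C0 C1 cCm _] uE _] := xE q xq.
  have rel := curvature_sign s cE q.
  rewrite /u uE; split.
  - exact: (theta_den_neq0 s c0 C0 C1 cCm rel).
  - by rewrite (theta_funE s c0 C0 C1 cCm rel) /theta angleE.
  - rewrite (derive1_theta_fun s c0 C0 C1 cCm rel) (sin_theta_fun s c0 C0 C1 cCm rel).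
    rewrite mulfK; last by rewrite gt_eqF// sqrtr_gt0 subr_gt0 expr_lt1// ltW.
    by rewrite mulrA mulrNN sgsg mul1r.
exists (fun y => y *m Q), G; split; first exact: isometry_orthogonal.
move=> q xq; have [ad uE vE] := xE q xq; have [C0 C1 cCm w0] := ad.
have [Gd Gh] := GP q ad; rewrite /u uE; split=> //.
have S0 : 0 < Num.sqrt (1 - xi q 0 3 ^+ 2).
  by rewrite sqrtr_gt0 subr_gt0 expr_lt1// ltW.
have rE : (F q *m Q) 0 1 ^+ 2 + (F q *m Q) 0 2 ^+ 2 =
    (Num.sqrt (1 - xi q 0 3 ^+ 2) / c) ^+ 2.
  rewrite (frame_radius hF c0 cE QQ Q3 Q0) exprMn exprVn sqr_sqrtr// subr_ge0.
  by rewrite expr_le1// ltW.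
have [cosE sE] := polar_coordinates (divr_gt0 S0 c0) w0 rE.
have cn : c != 0 by rewrite gt_eqF.
rewrite Gh sinE// /v vE /v_coordinate; apply/rowP; apply: forall_I4;
  rewrite [RHS]mxE vec4E.
- exact: Q0.
- by rewrite -[LHS]cosE; ring.
- by rewrite -[LHS]sE; ring.
- by rewrite Q3 mulKf.
Qed.
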